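(* Let $K$ be a field of positive prime characteristic, let $n$ and $t$ be positive integers with $t+1\leqslant n$, and let $X=(x_{ij})$ be an $n\times n$ symmetric matrix of indeterminates over $K$ (so $x_{ij}=x_{ji}$, and the distinct entries $x_{ij}$, $i\leqslant j$, are algebraically independent). Let $I_{t+1}(X)$ be the ideal of the polynomial ring $K[X]$ generated by the $(t+1)\times(t+1)$ minors of $X$. Then the ring $K[X]/I_{t+1}(X)$ is $F$-regular.
   Context: For $\mathbb{N}$-graded rings finitely generated over a field of positive characteristic, weak $F$-regularity, $F$-regularity and strong $F$-regularity coincide, so no distinction is made among them. *)

(* Defs.v *)
From HB Require Import structures.
From mathcomp Require Import all_boot all_order all_algebra.
From mathcomp Require Import mpoly.
Set Implicit Arguments. Unset Strict Implicit. Unset Printing Implicit Defensive.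
Import Order.TTheory GRing.Theory.
Local Open Scope ring_scope.

Definition symidx (n : nat) := {pr : 'I_n * 'I_n | (pr.1 <= pr.2)%N}.
Definition nsym (n : nat) : nat := #|{: symidx n}|.

Definition sympair (n : nat) (i j : 'I_n) : 'I_n * 'I_n :=
  if (i <= j)%N then (i, j) else (j, i).

Lemma sympair_le (n : nat) (i j : 'I_n) : ((sympair i j).1 <= (sympair i j).2)%N.
Proof. rewrite /sympair; case: (leqP i j) => //= H; exact: ltnW. Qed.

Definition symvar (n : nat) (i j : 'I_n) : 'I_(nsym n) :=
  enum_rank (exist (fun pr : 'I_n * 'I_n => (pr.1 <= pr.2)%N) (sympair i j) (sympair_le i j)).

Definition symX (K : fieldType) (n : nat) : 'M[{mpoly K[nsym n]}]_n :=
  \matrix_(i, j) 'X_(symvar i j).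

Definition ideal_span (R : comPzRingType) (S : R -> Prop) (q : R) : Prop :=
  exists s : seq (R * R), (forall x, x \in s -> S x.2) /\ q = \sum_(x <- s) x.1 * x.2.

Definition is_minor (R : comPzRingType) (n k : nat) (A : 'M[R]_n) (q : R) : Prop :=
  exists (f g : 'I_k -> 'I_n),
    (forall a b : 'I_k, (a < b)%N -> (f a < f b)%N) /\
    (forall a b : 'I_k, (a < b)%N -> (g a < g b)%N) /\
    q = \det (mxsub f g A).

Definition minors_ideal (K : fieldType) (n t : nat) : {mpoly K[nsym n]} -> Prop :=
  ideal_span (is_minor t.+1 (symX K n)).

Definition is_ideal (R : comPzRingType) (P : R -> Prop) : Prop :=
  P 0 /\ (forall a b, P a -> P b -> P (a + b)) /\ (forall r a, P a -> P (r * a)).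

Definition is_prime_ideal (R : comPzRingType) (P : R -> Prop) : Prop :=
  is_ideal P /\ ~ P 1 /\ (forall a b, P (a * b) -> P a \/ P b).

Definition is_minimal_prime (R : comPzRingType) (P : R -> Prop) : Prop :=
  is_prime_ideal P /\
  (forall Q : R -> Prop, is_prime_ideal Q -> (forall x, Q x -> P x) -> forall x, P x -> Q x).

(* (Strong) F-regularity of a ring R of characteristic p (Hochster's definition):
   for every c not in any minimal prime there is e and an R-linear map
   phi : F^e_* R -> R with phi(c) = 1, i.e. phi additive with
   phi (r^(p^e) s) = r phi(s). *)
Definition F_regular (p : nat) (R : comPzRingType) : Prop :=
  forall c : R, (forall P, is_minimal_prime P -> ~ P c) ->
  exists (e : nat) (phi : R -> R),
    (forall a b, phi (a + b) = phi a + phi b) /\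
    (forall r s, phi (r ^+ (p ^ e) * s) = r * phi s) /\
    phi c = 1.

(* Main.v *)
Require Import Defs.
From HB Require Import structures.
From mathcomp Require Import all_boot all_order all_fingroup all_algebra.
From mathcomp Require Import mpoly.
From mathcomp Require boolp classical_sets.
From mathcomp Require Import ring zify.
Set Implicit Arguments. Unset Strict Implicit. Unset Printing Implicit Defensive.
Import GRing.Theory.
Local Open Scope ring_scope.

(* The substitution X = Y^T Y, with Y a generic t x n matrix, has kernel I_{t+1}:
   monomials divisible by the main diagonal of a (t+1)-minor can be rewritten
   modulo I_{t+1}, and the remaining "standard" monomials have linearly
   independent images, because the support of such a monomial splits into t
   antichains and a weight adapted to them gives its image an initial monomial
   that determines it.  Hence I = I_{t+1} is prime.

   A map s |-> Tr(G s), with Tr the Frobenius trace of level q = p^e, preserves I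
   as soon as delta^M G lies in (z)^(h(q-1)) for some M, where delta is the
   leading principal t-minor and z_1, ..., z_h, with h the codimension of I, are
   polynomials generating I after inverting delta.  Two such maps suffice.
   Modulo I, a multiple delta^M c of a given c outside I is a polynomial in the
   first t rows of X, and the map with G a multiple of (z_1 ... z_h)^(q-1) can be
   arranged to send it to delta^h.  If delta' is the opposite principal t-minor
   and eps the corner t-minor (first t rows, last t columns), then
   delta delta' = eps^2 modulo I, so delta^h divides eps^(2h) there.  Finally the
   product of the corner minors of sizes 1, ..., n has order at least h along I,
   and its leading monomial is the product of all the variables; taking for G its
   (q-1)-st power divided by eps^(2h) gives a map sending eps^(2h) to 1. *)

(** * Leading forms for a weight *)

Section Weights.
Context (N : nat) (R : comNzRingType) (w : 'I_N -> nat).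
Implicit Types (p q : {mpoly R[N]}) (m : 'X_{1..N}) (d e : nat).

Definition wt m : nat := (\sum_i m i * w i)%N.

Lemma wtD m1 m2 : wt (m1 + m2)%MM = (wt m1 + wt m2)%N.
Proof. by rewrite /wt -big_split; apply: eq_bigr => i _; rewrite mnmDE mulnDl. Qed.

Lemma wt0 : wt 0%MM = 0%N.
Proof. by rewrite /wt big1 // => i _; rewrite mnm0E. Qed.

Lemma wt_sum (I : Type) (r : seq I) (P : pred I) (F : I -> 'X_{1..N}) :
  wt (\sum_(i <- r | P i) F i)%MM = (\sum_(i <- r | P i) wt (F i))%N.
Proof. exact: (big_morph wt wtD wt0). Qed.

Lemma wtU i : wt U_(i)%MM = w i.
Proof.
rewrite /wt (bigD1 i) //= mnm1E eqxx mul1n big1 ?addn0 // => j ji.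
by rewrite mnm1E eq_sym (negPf ji).
Qed.

Lemma wtMn m k : wt (m *+ k)%MM = (k * wt m)%N.
Proof.
rewrite /wt big_distrr /=; apply: eq_bigr => i _; rewrite mulmnE.
by rewrite mulnA (mulnC k).
Qed.

(** The bound is strict so that [wlt 0 p] means [p = 0], the start of inductions on weight. *)
Definition wlt d p := forall m, (d <= wt m)%N -> p@_m = 0.

Lemma wlt_mono d e p : (d <= e)%N -> wlt d p -> wlt e p.
Proof. by move=> de H m em; apply: H; apply: leq_trans em. Qed.

Lemma wlt_zero d : wlt d 0.
Proof. by move=> m _; rewrite mcoeff0. Qed.

Lemma wltD d p q : wlt d p -> wlt d q -> wlt d (p + q).
Proof. by move=> hp hq m dm; rewrite mcoeffD hp ?hq ?addr0. Qed.

Lemma wltN d p : wlt d p -> wlt d (- p).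
Proof. by move=> hp m dm; rewrite mcoeffN hp ?oppr0. Qed.

Lemma wlt_sum d (I : Type) (r : seq I) (P : pred I) (F : I -> {mpoly R[N]}) :
  (forall i, P i -> wlt d (F i)) -> wlt d (\sum_(i <- r | P i) F i).
Proof.
by move=> H; elim/big_ind: _ => //; [exact: wlt_zero | exact: wltD].
Qed.

Lemma wltM d e p q : wlt d.+1 p -> wlt e q -> wlt (d + e) (p * q).
Proof.
move=> hp hq m dem; rewrite mcoeffM big1 // => k /eqP mE.
have [lt_d|le_d] := ltnP d (wt k.1); first by rewrite hp ?mul0r.
rewrite (hq k.2) ?mulr0 // -(leq_add2l d).
by have E := congr1 wt mE; rewrite wtD in E; rewrite (leq_trans dem) // E leq_add2r.
Qed.

Lemma wltX d m : (wt m < d)%N -> wlt d 'X_[m].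
Proof.
move=> md m' dm'; rewrite mcoeffX; case: eqP => // E.
by move: dm'; rewrite -E leqNgt md.
Qed.

Lemma wltC d c : (0 < d)%N -> wlt d c%:MP.
Proof.
move=> d0 m dm; rewrite mcoeffC; case: eqP => [E|_]; last by rewrite mulr0.
by move: dm; rewrite E wt0 leqNgt d0.
Qed.

(* [q] carries the part of [p] of weight at least [d], and [p] has none above [d]. *)
Definition wlead d p q := wlt d.+1 q /\ wlt d (p - q).

Lemma wlead_refl d p : wlt d.+1 p -> wlead d p p.
Proof. by move=> H; split=> //; rewrite subrr; apply: wlt_zero. Qed.

Lemma wlead_le d p q : wlead d p q -> wlt d.+1 p.
Proof.
case=> hq h; rewrite -(subrK q p); apply: wltD => //.
by apply: wlt_mono h.
Qed.

Lemma wlead_coeff d p q m : wlead d p q -> (d <= wt m)%N -> p@_m = q@_m.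
Proof. by case=> _ h /h; rewrite mcoeffB => /eqP; rewrite subr_eq0 => /eqP. Qed.

Lemma wleadD d p q p' q' :
  wlead d p q -> wlead d p' q' -> wlead d (p + p') (q + q').
Proof.
case=> h1 h2 [h3 h4]; split; first exact: wltD.
by rewrite opprD addrACA; apply: wltD.
Qed.

Lemma wlead_sum d (I : Type) (r : seq I) (P : pred I) (F G : I -> {mpoly R[N]}) :
  (forall i, P i -> wlead d (F i) (G i)) ->
  wlead d (\sum_(i <- r | P i) F i) (\sum_(i <- r | P i) G i).
Proof.
move=> H; elim/big_ind2: _ => //; last by move=> *; apply: wleadD.
by apply: wlead_refl; apply: wlt_zero.
Qed.

Lemma wleadM d e p q p' q' :
  wlead d p q -> wlead e p' q' -> wlead (d + e) (p * p') (q * q').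
Proof.
move=> H1 H2; have h1 := wlead_le H1; have h2 := wlead_le H2.
case: H1 H2 => h3 h4 [h5 h6]; split; first by rewrite -addnS; apply: wltM.
have -> : p * p' - q * q' = p * (p' - q') + (p - q) * q' by ring.
by apply: wltD; [apply: wltM | rewrite mulrC addnC; apply: wltM].
Qed.

Lemma wlead_prod (I : Type) (r : seq I) (P : pred I) (F G : I -> {mpoly R[N]})
    (d : I -> nat) :
  (forall i, P i -> wlead (d i) (F i) (G i)) ->
  wlead (\sum_(i <- r | P i) d i) (\prod_(i <- r | P i) F i)
        (\prod_(i <- r | P i) G i).
Proof.
move=> H; elim: r => [|a r IH].
  by rewrite !big_nil; apply: wlead_refl; rewrite -mpolyC1; apply: wltC.
by rewrite !big_cons; case: ifP => // Pa; apply: wleadM => //; apply: H.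
Qed.

Lemma wleadXn d p q k : wlead d p q -> wlead (k * d) (p ^+ k) (q ^+ k).
Proof.
move=> H; elim: k => [|k IH]; last by rewrite mulSn !exprS; apply: wleadM.
by rewrite !expr0; apply: wlead_refl; rewrite -mpolyC1; apply: wltC.
Qed.

End Weights.

Lemma mpoly_subring_ind (N : nat) (R : comNzRingType) (P : {mpoly R[N]} -> Prop) :
  (forall c, P c%:MP) -> (forall i, P 'X_i) ->
  (forall p q, P p -> P q -> P (p + q)) ->
  (forall p q, P p -> P q -> P (p * q)) -> forall p, P p.
Proof.
move=> PC PX PD PM p.
have P1 : P 1 by rewrite -mpolyC1.
move: p; apply: mpolyind => [|c m p _ _ Pp]; first by rewrite -mpolyC0.
apply: (PD) => //; rewrite -mul_mpolyC; apply: (PM) => //.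
rewrite mpolyXE_id; elim/big_ind: _ => // i _.
by elim: (m i) => [|k IH]; rewrite ?expr0 // exprS; apply: PM.
Qed.

(** * Determinants and the rearrangement inequality *)

Lemma monotone_perm_id (k : nat) (s : 'S_k) :
  (forall i j : 'I_k, (i < j)%N -> (s i < s j)%N) -> s = 1%g.
Proof.
have ge_id (u : 'S_k) : (forall i j : 'I_k, (i < j)%N -> (u i < u j)%N) ->
    forall i : 'I_k, (i <= u i)%N.
  move=> H [i hi] /=; elim: i hi => // i IH hi.
  have hi' : (i < k)%N by apply: ltnW.
  by apply: leq_ltn_trans (IH hi') (H (Ordinal hi') (Ordinal hi) _) => /=.
move=> H; apply/permP => i; rewrite perm1; apply/val_inj/eqP => /=.
rewrite eqn_leq (ge_id s H) andbT.
rewrite -{2}(permK s i); apply: ge_id => a b ab.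
rewrite ltnNge; apply/negP => ba.
have: ((s^-1)%g b != (s^-1)%g a :> nat).
  by apply/eqP => /val_inj /perm_inj E; rewrite E ltnn in ab.
move=> ne; have lt : ((s^-1)%g b < (s^-1)%g a)%N by rewrite ltn_neqAle ne.
by have := H _ _ lt; rewrite !permKV => /(ltn_trans ab); rewrite ltnn.
Qed.

(** A permutation other than the identity has an inversion, and undoing it by a transposition
    strictly raises the sum. So a maximizing permutation must be the identity. *)
Lemma rearrangement_lt (k : nat) (a b : 'I_k -> nat) (s : 'S_k) :
  (forall i j : 'I_k, (i < j)%N -> (a i < a j)%N) ->
  (forall i j : 'I_k, (i < j)%N -> (b i < b j)%N) ->
  s != 1%g -> (\sum_i a i * b (s i) < \sum_i a i * b i)%N.
Proof.
move=> ha hb; pose V (u : 'S_k) := (\sum_i a i * b (u i))%N.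
have step (u : 'S_k) : u != 1%g -> exists v : 'S_k, (V u < V v)%N.
  move=> u1; have [/existsP [i /existsP [j /andP [ij ji]]]|/existsP H] :=
      boolP [exists i : 'I_k, exists j : 'I_k, (i < j)%N && (u j < u i)%N]; last first.
    case/eqP: u1; apply: monotone_perm_id => i j ij.
    rewrite ltn_neqAle; apply/andP; split.
      by apply/eqP => /val_inj /perm_inj E; rewrite E ltnn in ij.
    rewrite leqNgt; apply/negP => ji.
    by apply: H; exists i; apply/existsP; exists j; rewrite ij.
  exists (tperm i j * u)%g; rewrite /V.
  have ji' : j != i by apply/eqP => E; rewrite E ltnn in ij.
  rewrite (bigD1 i) //= (bigD1 j) //= [X in (_ < X)%N](bigD1 i) //=.
  rewrite [X in (_ < _ + X)%N](bigD1 j) //= !permM tpermL tpermR.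
  rewrite !addnA; set r := \big[_/_]_(_ | _) _; set r' := \big[_/_]_(_ | _) _.
  have -> : r' = r.
    by apply: eq_bigr => l /andP [li lj]; rewrite permM tpermD // eq_sym.
  by rewrite ltn_add2r; have := ha _ _ ij; have := hb _ _ ji; nia.
have [m _ mmax] := arg_maxnP V (erefl : xpredT (1%g : 'S_k)).
have m1 : m = 1%g.
  by apply/eqP/negP => /negP /step [v]; rewrite ltnNge => /negP; apply; apply: mmax.
move=> /step [v vlt]; have -> : (\sum_i a i * b i = V m)%N.
  by rewrite m1; apply: eq_bigr => i _; rewrite perm1.
by apply: leq_trans vlt (mmax _ _).
Qed.

Section DetLead.
Context (N : nat) (R : comNzRingType) (w : 'I_N -> nat).

Lemma wlead_det (k : nat) (A : 'M[{mpoly R[N]}]_k) (e : 'I_k -> 'I_k -> nat) :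
  (forall i j, wlt w (e i j).+1 (A i j)) ->
  (forall s : 'S_k, s != 1%g -> (\sum_i e i (s i) < \sum_i e i i)%N) ->
  wlead w (\sum_i e i i) (\det A) (\prod_i A i i).
Proof.
move=> hA he.
have bound (s : 'S_k) : wlt w (\sum_i e i (s i)).+1 (\prod_i A i (s i)).
  have [|//] := @wlead_prod N R w _ (index_enum 'I_k) xpredT (fun i => A i (s i))
    (fun i => A i (s i)) (fun i => e i (s i)).
  by move=> i _; apply: wlead_refl.
have E1 : \prod_i A i i = \prod_i A i ((1%g : 'S_k) i).
  by apply: eq_bigr => i _; rewrite perm1.
split.
  rewrite E1; apply: wlt_mono (bound 1%g); rewrite ltnS; apply: eq_leq.
  by apply: eq_bigr => i _; rewrite perm1.
rewrite /determinant (bigD1 1%g) //= odd_perm1 expr0 mul1r -E1 addrAC subrr add0r.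
apply: wlt_sum => s /he lt.
have := wlt_mono lt (bound s); case: (odd_perm s).
  by rewrite expr1 mulN1r; apply: wltN.
by rewrite expr0 mul1r.
Qed.

End DetLead.

(* [F] plays the role of the powers of an ideal; with [F d.+1 = {0}] the bound
   says that a product of rank less than its size has determinant zero. *)
Lemma det_filtration (R : comNzRingType) (F : nat -> R -> Prop) (s t : nat)
    (Z : 'M[R]_s) (U : 'M[R]_(s, t)) (W : 'M[R]_(t, s)) :
  (forall x, F 0%N x) -> (forall d, F d 0) ->
  (forall d e x, (d <= e)%N -> F e x -> F d x) ->
  (forall d x y, F d x -> F d y -> F d (x + y)) ->
  (forall d e x y, F d x -> F e y -> F (d + e)%N (x * y)) ->
  (forall i j, F 1%N (Z i j)) -> F (s - t)%N (\det (Z + U *m W)).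
Proof.
move=> F0 Fz Fle FD FM hZ.
(* [Z + U *m W] is the Schur complement of the identity block of [M], so both have the same
   determinant. *)
pose M := block_mx Z (- U) W (1%:M : 'M_t).
have -> : \det (Z + U *m W) = \det M.
  have : M *m block_mx 1%:M 0 (- W) 1%:M = block_mx (Z + U *m W) (- U) 0 1%:M.
    by rewrite mulmx_block !mulmx1 !mulmx0 !mul1mx !add0r mulNmx mulmxN opprK subrr.
  move/(congr1 determinant); rewrite det_mulmx det_lblock det_ublock !det1.
  by rewrite !mulr1 => ->.
rewrite /determinant; elim/big_ind: _ => //; first by move=> x y; apply: FD.
move=> u _; rewrite -[(s - t)%N]add0n; apply: (FM) => //.
rewrite big_split_ord /= -[(s - t)%N]addn0; apply: (FM) => //.
(* [small i] says that the term takes an entry of [Z] from row [i]. At most [t] of the first [s]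
   rows can use the last [t] columns, so at least [s - t] factors come from [Z]. *)
pose small (i : 'I_s) := (u (lshift t i) < s)%N.
apply: (Fle _ (\sum_i small i)%N).
  pose big := [set i : 'I_s | ~~ small i].
  have cb : (#|big| <= t)%N.
    have inj : injective (fun i : 'I_s => u (lshift t i)).
      by move=> x y /perm_inj /lshift_inj.
    rewrite -(card_imset _ inj) -[X in (_ <= X)%N]card_ord.
    rewrite -(card_imset _ (@rshift_inj s t)); apply: subset_leq_card.
    apply/subsetP => y /imsetP [i]; rewrite inE /small => hi ->.
    case: (splitP (u (lshift t i))) hi => [//|j E _].
    by apply/imsetP; exists j => //; apply: val_inj; rewrite /= E.
  rewrite leq_subLR; have := cardC (mem big); rewrite card_ord => {1}<-.
  apply: leq_add => //; rewrite -sum1_card big_mkcond /=; apply: leq_sum => i _.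
  by rewrite !inE negbK; case: (small i).
elim/big_rec2: _ => [|i d x _ H]; first exact: F0.
apply: (FM) => //; rewrite /small.
case: ltnP => // hi.
have -> : u (lshift t i) = lshift t (Ordinal hi) by apply: val_inj.
by rewrite /M block_mxEul.
Qed.

Lemma det_low_rank (R : comNzRingType) (s t : nat) (U : 'M[R]_(s, t))
  (W : 'M[R]_(t, s)) : (t < s)%N -> \det (U *m W) = 0.
Proof.
move=> ts; rewrite -[U *m W]add0r.
pose F d (x : R) := (0 < d)%N -> x = 0.
have := @det_filtration R F s t 0 U W; apply; rewrite ?subn_gt0 //.
- by move=> d e x de h d0; apply: h; apply: leq_trans de.
- by move=> d x y hx hy d0; rewrite hx ?hy ?addr0.
- move=> d e x y hx hy; case: d hx => [|d] hx de; last by rewrite hx ?mul0r.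
  by rewrite hy ?mulr0.
- by move=> i j _; rewrite mxE.
Qed.

(** * Straightening modulo the minors *)

Section SymVariables.
Context (n : nat).
Implicit Types (i j k : 'I_n) (v : 'I_(nsym n)).

Definition sympr v : 'I_n * 'I_n := val (enum_val v).

Lemma sympr_le v : ((sympr v).1 <= (sympr v).2)%N.
Proof. exact: valP (enum_val v). Qed.

Lemma sympr_symvar i j : sympr (symvar i j) = sympair i j.
Proof. by rewrite /sympr /symvar enum_rankK. Qed.

Lemma symvar_sympr v : symvar (sympr v).1 (sympr v).2 = v.
Proof.
apply: (can_inj enum_valK); rewrite /symvar enum_rankK; apply: val_inj => /=.
by rewrite /sympair sympr_le -surjective_pairing.
Qed.

Lemma sympairC i j : sympair i j = sympair j i.
Proof.
by rewrite /sympair; case: ltngtP => // /val_inj ->.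
Qed.

Lemma symvarC i j : symvar i j = symvar j i.
Proof. by rewrite /symvar; congr enum_rank; apply: val_inj; apply: sympairC. Qed.

Lemma sympair_cases i j : sympair i j = (i, j) \/ sympair i j = (j, i).
Proof. by rewrite /sympair; case: ifP; [left | right]. Qed.

Lemma symvar_eq i j i' j' :
  symvar i j = symvar i' j' -> (i, j) = (i', j') \/ (i, j) = (j', i').
Proof.
move/(congr1 sympr); rewrite !sympr_symvar.
case: (sympair_cases i j) => ->; case: (sympair_cases i' j') => -> [-> ->];
  by [left | right].
Qed.

Lemma sympr_eq (T : Type) (h : 'I_n -> 'I_n -> T) i j :
  (forall a b, h a b = h b a) ->
  h (sympr (symvar i j)).1 (sympr (symvar i j)).2 = h i j.
Proof. by move=> hC; rewrite sympr_symvar; case: (sympair_cases i j) => ->. Qed.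

(** The product of one-based indices makes the main diagonal the leading term of a minor. Doubling
    and adding [n * n] do not affect this, and let [yweight] share its constant evenly between two
    variables within the natural numbers. *)
Definition symw v : nat :=
  (2 * ((sympr v).1.+1 * (sympr v).2.+1 + n * n))%N.

Lemma symw_symvar i j : symw (symvar i j) = (2 * (i.+1 * j.+1 + n * n))%N.
Proof.
rewrite /symw (sympr_eq (h := fun i j => 2 * (i.+1 * j.+1 + n * n))%N) // => a b.
by rewrite [(b.+1 * _)%N]mulnC.
Qed.

End SymVariables.

Definition increasing (k n : nat) (f : 'I_k -> 'I_n) : Prop :=
  forall a b : 'I_k, (a < b)%N -> (f a < f b)%N.

Lemma wlead_minor (K : fieldType) (n k : nat) (f g : 'I_k -> 'I_n) :
  increasing f -> increasing g ->
  wlead (@symw n) (\sum_a symw (symvar (f a) (g a)))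
    (\det (mxsub f g (symX K n))) (\prod_a 'X_(symvar (f a) (g a))).
Proof.
move=> hf hg.
have H := @wlead_det _ K (@symw n) k (mxsub f g (symX K n))
  (fun a b => symw (symvar (f a) (g b))).
have -> : \prod_a 'X_(symvar (f a) (g a)) = \prod_a (mxsub f g (symX K n)) a a.
  by apply: eq_bigr => a _; rewrite !mxE.
apply: H => [a b|s s1]; first by rewrite !mxE; apply: wltX; rewrite wtU.
have E (u : 'S_k) : (\sum_i symw (symvar (f i) (g (u i))) =
   2 * (\sum_i (f i).+1 * (g (u i)).+1) + \sum_(i < k) 2 * (n * n))%N.
  rewrite big_distrr -big_split; apply: eq_bigr => i _.
  by rewrite symw_symvar mulnDr.
have -> : (\sum_i symw (symvar (f i) (g i)) =
   2 * (\sum_i (f i).+1 * (g i).+1) + \sum_(i < k) 2 * (n * n))%N.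
  rewrite big_distrr -big_split; apply: eq_bigr => i _.
  by rewrite symw_symvar mulnDr.
rewrite E ltn_add2r ltn_pmul2l //.
by apply: (rearrangement_lt (a := fun i => (f i).+1) (b := fun i => (g i).+1)).
Qed.

Section IdealSpan.
Context (R : comPzRingType) (S : R -> Prop).

Lemma ideal_span0 : ideal_span S 0.
Proof. by exists [::]; rewrite big_nil. Qed.

Lemma ideal_spanD a b : ideal_span S a -> ideal_span S b -> ideal_span S (a + b).
Proof.
move=> [s [hs ->]] [s' [hs' ->]]; exists (s ++ s'); rewrite big_cat; split=> // x.
by rewrite mem_cat => /orP [/hs|/hs'].
Qed.

Lemma ideal_spanM r a : ideal_span S a -> ideal_span S (r * a).
Proof.
move=> [s [hs ->]]; exists [seq (r * x.1, x.2) | x <- s]; split.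
  by move=> x /mapP [y ys ->] /=; apply: hs.
by rewrite big_map big_distrr; apply: eq_bigr => y _ /=; rewrite mulrA.
Qed.

Lemma ideal_span_sum (I : Type) (r : seq I) (P : pred I) (F : I -> R) :
  (forall i, P i -> ideal_span S (F i)) ->
  ideal_span S (\sum_(i <- r | P i) F i).
Proof.
move=> H; elim/big_ind: _ => //; [exact: ideal_span0 | exact: ideal_spanD].
Qed.

Lemma ideal_span_gen a : S a -> ideal_span S a.
Proof.
move=> ha; exists [:: (1, a)]; rewrite big_seq1 mul1r; split=> // x.
by rewrite inE => /eqP ->.
Qed.

Lemma ideal_span_min (J : R -> Prop) : is_ideal J -> (forall a, S a -> J a) ->
  forall a, ideal_span S a -> J a.
Proof.
move=> [J0 [JD JM]] SJ a [s [hs ->]]; rewrite big_seq.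
by elim/big_ind: _ => // i /hs /SJ; apply: JM.
Qed.

End IdealSpan.

Section Straightening.
Context (K : fieldType) (n t : nat).
Implicit Types (m : 'X_{1..nsym n}) (p : {mpoly K[nsym n]}).

(* The monomials outside the initial ideal generated by the main diagonals of
   the minors of size [t.+1]. *)
Definition standard m : Prop :=
  forall f g : 'I_t.+1 -> 'I_n, increasing f -> increasing g ->
  exists a, m (symvar (f a) (g a)) = 0%N.

Definition standardp p : Prop := forall m, p@_m != 0 -> standard m.

(** As [f] and [g] both increase, the diagonal entries are distinct variables even after [x_ij] and
    [x_ji] are identified. The diagonal is thus squarefree. *)
Lemma diag_le (k : nat) (f g : 'I_k -> 'I_n) m : increasing f -> increasing g ->
  (forall a, m (symvar (f a) (g a)) != 0%N) ->
  (\sum_a U_(symvar (f a) (g a)) <= m)%MM.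
Proof.
move=> hf hg hm; apply/mnm_lepP => v; rewrite mnm_sumE.
have [/existsP [a /eqP va]|/existsP H] := boolP [exists a, symvar (f a) (g a) == v].
  rewrite (bigD1 a) //= -va mnm1E eqxx big1; first by rewrite addn0 lt0n.
  move=> b ba; rewrite mnm1E; case: eqP => // E; exfalso; move/eqP: ba; apply.
  have: ~ (b < a)%N /\ ~ (a < b)%N.
    split=> lt; have lf := hf _ _ lt; have lg := hg _ _ lt;
    by case: (symvar_eq E) => [] [e1 e2]; rewrite e1 e2 in lf lg; lia.
  by move=> [/negP h1 /negP h2]; apply/val_inj/eqP; rewrite eqn_leq leqNgt h2 leqNgt.
rewrite big1 // => a _; rewrite mnm1E; case: eqP => // E.
by case: H; exists a; apply/eqP.
Qed.

Lemma not_standard m : ~ standard m -> exists f g : 'I_t.+1 -> 'I_n,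
  [/\ increasing f, increasing g & forall a, m (symvar (f a) (g a)) != 0%N].
Proof.
move=> H; apply: boolp.contrapT => H'; apply: H => f g hf hg.
apply: boolp.contrapT => H; apply: H'; exists f, g; split=> // a.
by apply/eqP => E; apply: H; exists a.
Qed.

(** By induction on the weight: a diagonal dividing a monomial is traded for the diagonal minus its
    minor, all of whose terms have smaller weight. *)
Lemma straighten p :
  exists g, standardp g /\ @minors_ideal K n t (p - g).
Proof.
have main d : forall q : {mpoly K[nsym n]}, wlt (@symw n) d q ->
    exists g, standardp g /\ @minors_ideal K n t (q - g); last first.
  pose d := (\max_(m <- msupp p) (wt (@symw n) m).+1)%N.
  apply: (main d) => m; rewrite leqNgt => dm; apply/eqP; rewrite mcoeff_eq0.
  apply: contra dm => mp.
  by apply: (@leq_bigmax_seq _ _ xpredT (fun m => (wt (@symw n) m).+1)).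
elim: d => [|d IH] q hq.
  exists 0; split; first by move=> m; rewrite mcoeff0 eqxx.
  suff -> : q = 0 by rewrite subr0; apply: ideal_span0.
  by apply/mpolyP => m; rewrite mcoeff0 hq.
rewrite [q]mpolyE; rewrite big_seq; elim/big_ind: _ => [|a b [g [hg Ig]] [h [hh Ih]]|m mq].
- exists 0; split; first by move=> m; rewrite mcoeff0 eqxx.
  by rewrite subr0; apply: ideal_span0.
- exists (g + h); split; last by rewrite opprD addrACA; apply: ideal_spanD.
  move=> m; rewrite mcoeffD; have [->|/hg//] := eqVneq g@_m 0.
  by rewrite add0r => /hh.
have md : (wt (@symw n) m <= d)%N.
  by rewrite leqNgt; apply/negP => /hq E; move: mq; rewrite mcoeff_msupp E eqxx.
have [g [hg Ig]] : exists g, standardp g /\ @minors_ideal K n t ('X_[m] - g).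
  have [Sm|/not_standard [f [g [hf hg H]]]] := boolp.pselect (standard m).
    exists 'X_[m]; split; last by rewrite subrr; apply: ideal_span0.
    by move=> m'; rewrite mcoeffX; have [<- //|_] := eqVneq m m'; rewrite eqxx.
  have /submK E := diag_le hf hg H.
  set m' := (m - _)%MM in E; set dg := (\sum_a _)%MM in E.
  have dgX : \prod_a 'X_(symvar (f a) (g a)) = 'X_[K, dg] by rewrite mprodXE.
  have [_ L] := wlead_minor K hf hg; rewrite dgX in L.
  have wdg : (\sum_a symw (symvar (f a) (g a)) = wt (@symw n) dg)%N.
    by rewrite wt_sum; apply: eq_bigr => a _; rewrite wtU.
  set M := \det _ in L.
  have L' : wlt (@symw n) d ('X_[m'] * ('X_[dg] - M)).
    apply: (wlt_mono md); rewrite -E wtD -wdg; apply: wltM; first exact: wltX.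
    by rewrite -opprB; apply: wltN.
  have [h [hh Ih]] := IH _ L'.
  exists h; split=> //.
  have -> : 'X_[m] - h = 'X_[m'] * M + ('X_[m'] * ('X_[dg] - M) - h).
    by rewrite -E mpolyXD; ring.
  apply: ideal_spanD => //; apply: ideal_spanM; apply: ideal_span_gen.
  by exists f, g.
exists (q@_m *: g); split; last by rewrite -scalerBr -mul_mpolyC; apply: ideal_spanM.
by move=> m'; rewrite mcoeffZ mulf_eq0 negb_or => /andP [_ /hg].
Qed.

End Straightening.

(** * Layers of a set of positions *)

Section Layers.
Context (n : nat).
Implicit Types (x y z : 'I_n * 'I_n) (F G : {set 'I_n * 'I_n}).

Definition lt2 x y := (x.1 < y.1)%N && (x.2 < y.2)%N.
Definition le2 x y := (x.1 <= y.1)%N && (x.2 <= y.2)%N.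
Definition swap2 x := (x.2, x.1).

(** Each peeling discards the points with nothing of [F] strictly above them in both coordinates, so
    [layer k F] holds the points that start a strict chain of [k.+1] points of [F]. *)
Definition peel F := [set x in F | [exists y in F, lt2 x y]].
Definition layer k F := iter k peel F.
Definition down G := [set x | [exists y in G, le2 x y]].
(** The rim is that of the whole order ideal, because this is exactly where the inequality [rows_le]
    is an equality. *)
Definition rim G := [set x in down G | ~~ [exists y in down G, lt2 x y]].

Lemma lt2_trans : transitive lt2.
Proof.
by move=> y x z /andP [a b] /andP [c d]; rewrite /lt2 (ltn_trans a c) (ltn_trans b d).
Qed.

Lemma lt2_le2_trans x y z : lt2 x y -> le2 y z -> lt2 x z.
Proof. by move=> /andP [a b] /andP [c d]; rewrite /lt2 (leq_trans a c) (leq_trans b d). Qed.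

Lemma le2_lt2_trans x y z : le2 x y -> lt2 y z -> lt2 x z.
Proof.
by move=> /andP [a b] /andP [c d]; rewrite /lt2 (leq_ltn_trans a c) (leq_ltn_trans b d).
Qed.

Lemma le2_trans : transitive le2.
Proof.
by move=> y x z /andP [a b] /andP [c d]; rewrite /le2 (leq_trans a c) (leq_trans b d).
Qed.

Definition symset G := forall x, x \in G -> swap2 x \in G.

Lemma layer_sym k F : symset F -> symset (layer k F).
Proof.
move=> sF; elim: k => //= k IH x; rewrite !inE => /andP [xk /existsP [y /andP [yk xy]]].
rewrite IH //=; apply/existsP; exists (swap2 y); rewrite IH //=.
by move: xy; rewrite /lt2 andbC.
Qed.

Lemma down_sym G : symset G -> symset (down G).
Proof.
move=> sG x; rewrite !inE => /existsP [y /andP [yG xy]]; apply/existsP; exists (swap2 y).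
by rewrite sG //=; move: xy; rewrite /le2 andbC.
Qed.

Lemma rim_antichain G x y : x \in rim G -> y \in rim G -> ~~ lt2 x y.
Proof.
rewrite !inE => /andP [_ nx] /andP [yd _]; apply: contra nx => xy.
by apply/existsP; exists y; rewrite xy !inE yd.
Qed.

Lemma rim_sym G : symset G -> symset (rim G).
Proof.
move=> /down_sym sG x; rewrite !inE => /andP [xd nx].
apply/andP; split; first by have := sG x; rewrite !inE => /(_ xd).
apply: contra nx => /existsP [y /andP [yd xy]]; apply/existsP; exists (swap2 y).
by rewrite sG //=; move: xy; rewrite /lt2 andbC.
Qed.

Lemma layer_chain k F x : x \in layer k F ->
  exists s, [/\ path lt2 x s, size s = k & all (mem F) (x :: s)].
Proof.
have sub l : layer l F \subset F.
  by elim: l => //= l IH; apply: subset_trans IH; apply/subsetP => y; rewrite inE => /andP [].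
elim: k x => [|k IH] x /=; first by exists [::]; rewrite /= andbT.
rewrite inE => /andP [xk /existsP [y /andP [/IH [s [ps ss sF]] xy]]].
exists (y :: s); split; rewrite /= ?xy ?ss //.
by rewrite (subsetP (sub k)) //; move: sF => /= ->.
Qed.

Lemma rim_cover t F x : layer t F = set0 -> x \in F ->
  exists2 k, (k < t)%N & x \in rim (layer k F).
Proof.
move=> F0 xF.
have : exists2 k, (k < t)%N & (x \in layer k F) && (x \notin layer k.+1 F).
  elim: t F0 => [|t IH] F0; first by move: xF; rewrite -[F]/(layer 0 F) F0 inE.
  have [xt|xt] := boolP (x \in layer t F).
    by exists t => //; rewrite xt F0 inE.
  elim: {IH F0} t xt => [|t IH] xt; first by rewrite xF in xt.
  have [xt'|xt'] := boolP (x \in layer t F).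
    by exists t; rewrite ?xt' // ltnW.
  by have [k kt] := IH xt'; exists k => //; rewrite ltnW.
move=> [k kt /andP [xk xk1]]; exists k => //.
rewrite !inE; apply/andP; split.
  by apply/existsP; exists x; rewrite xk /le2 !leqnn.
apply: contra xk1 => /existsP [y /andP []]; rewrite inE => /existsP [z /andP [zk yz]] xy.
rewrite /= inE xk; apply/existsP; exists z; rewrite zk.
exact: lt2_le2_trans xy yz.
Qed.

(** If [a < b], a point of the rim of layer [b] is weakly below a point of that layer, which is
    strictly below a point of layer [a]. It is therefore off the rim of layer [a]. *)
Lemma rim_disjoint k l F x :
  x \in rim (layer k F) -> x \in rim (layer l F) -> k = l.
Proof.
have main a b : (a < b)%N -> x \in rim (layer a F) -> x \in rim (layer b F) -> False.
  move=> ab; rewrite !inE => /andP [_ nx] /andP [/existsP [y /andP [yb xy]] _].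
  have ya : y \in layer a.+1 F.
    elim: b ab yb => // b IH; rewrite ltnS leq_eqVlt => /orP [/eqP -> //|ab].
    by rewrite /= inE => /andP [yb _]; apply: IH.
  move: ya; rewrite /= inE => /andP [_ /existsP [z /andP [za yz]]].
  case/negP: nx; apply/existsP; exists z; rewrite (le2_lt2_trans xy yz) andbT.
  by rewrite inE; apply/existsP; exists z; rewrite za /le2 !leqnn.
by move=> xk xl; case: (ltngtP k l) => // h; [case: (main _ _ h xk xl) | case: (main _ _ h xl xk)].
Qed.

(* A symmetric potential for the cost [i j], exact on the rim: both sides count
   the points of the order ideal [B] in the rows up to [i] and columns up to [j]. *)
Definition rows G (i : 'I_n) := #|[set b in down G | (b.1 <= i)%N]|.

Lemma rows_le G (x : 'I_n * 'I_n) : symset G ->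
  (rows G x.1 + rows G x.2 <= #|down G| + x.1.+1 * x.2.+1 ?= iff (x \in rim G))%N.
Proof.
move=> sG; set B := down G; have sB : symset B := down_sym sG.
pose P := [set b in B | (b.1 <= x.1)%N]; pose Q := [set b in B | (b.2 <= x.2)%N].
have -> : rows G x.2 = #|Q|.
  rewrite /rows -(card_imset _ (can_inj (fun y : 'I_n * 'I_n =>
     esym (surjective_pairing y) : swap2 (swap2 y) = y))).
  apply: eq_card => y; apply/imsetP/idP => [[z]|]; rewrite !inE.
    by move=> /andP [zB z1] ->; have := sB z; rewrite !inE => /(_ zB) -> /=.
  move=> /andP [yB y2]; exists (swap2 y); last by case: (y).
  by rewrite !inE /= y2 andbT; have := sB y; rewrite !inE => /(_ yB).
rewrite -[rows G x.1]/#|P| -cardsUI.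
pose Rc := setX [set a : 'I_n | (a <= x.1)%N] [set a : 'I_n | (a <= x.2)%N].
have card_le (a : 'I_n) : #|[set b : 'I_n | (b <= a)%N]| = a.+1.
  have inj : injective (widen_ord (ltn_ord a)) by move=> u v [] /val_inj.
  have := card_ord a.+1; rewrite -(card_imset _ inj) => <-.
  apply: eq_card => b; rewrite inE; apply/idP/imsetP => [ba|[c _ ->]].
    by exists (Ordinal (ba : (b < a.+1)%N)) => //; apply: val_inj.
  by rewrite /= -ltnS ltn_ord.
have -> : (x.1.+1 * x.2.+1 = #|Rc|)%N by rewrite cardsX !card_le.
(* After inclusion-exclusion, equality here means that no point of [B] is strictly above [x], and
   equality in [H2] that [x] lies in [B]. *)
have H1 : (#|P :|: Q| <= #|B| ?= iff (P :|: Q == B))%N.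
  by apply: subset_leqif_cards; apply/subsetP => y; rewrite !inE => /orP [] /andP [].
have H2 : (#|P :&: Q| <= #|Rc| ?= iff (P :&: Q == Rc))%N.
  apply: subset_leqif_cards; apply/subsetP => y; rewrite !inE.
  by move=> /andP [/andP [_ ->] /andP [_ ->]].
have := leqif_add H1 H2; congr (leqif _ _ _); apply/idP/idP.
  move=> /andP [/eqP e1 /eqP e2]; rewrite inE; apply/andP; split.
    by have : x \in P :&: Q by [rewrite e2 !inE !leqnn]; rewrite !inE => /andP [/andP []].
  apply/negP => /existsP [y /andP [yB xy]].
  have : y \in P :|: Q by rewrite e1.
  move: xy; rewrite /lt2 !ltnNge => /andP [h1 h2].
  by rewrite !inE (negPf h1) (negPf h2) !andbF.
rewrite inE => /andP [xB nx]; apply/andP; split; rewrite eqEsubset; apply/andP; split.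
- by apply/subsetP => y; rewrite !inE => /orP [] /andP [].
- apply/subsetP => y yB; move: (yB); rewrite !inE -/B => -> /=.
  case: leqP => //= h1; case: leqP => //= h2; case/negP: nx.
  by apply/existsP; exists y; rewrite yB /lt2 h1.
- by apply/subsetP => y; rewrite !inE => /andP [/andP [_ ->] /andP [_ ->]].
- apply/subsetP => y; rewrite !inE => /andP [h1 h2]; rewrite h1 h2 !andbT andbb.
  move: xB; rewrite inE => /existsP [z /andP [zG xz]]; apply/existsP; exists z.
  by rewrite zG (le2_trans _ xz) // /le2 h1.
Qed.

End Layers.

(** * Primality of the determinantal ideal *)

Lemma exists_max_seq (T : eqType) (f : T -> nat) (s : seq T) : s != [::] ->
  exists2 x, x \in s & forall y, y \in s -> (f y <= f x)%N.
Proof.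
elim: s => // a s IH _; have [->|/IH [x xs xmax]] := eqVneq s [::].
  by exists a; rewrite ?inE // => y; rewrite inE => /eqP ->.
have [le|lt] := leqP (f a) (f x).
  exists x; first by rewrite inE xs orbT.
  by move=> y; rewrite inE => /orP [/eqP ->|/xmax].
exists a; first by rewrite inE eqxx.
move=> y; rewrite inE => /orP [/eqP -> //|/xmax h]; exact: leq_trans h (ltnW lt).
Qed.

Section Parametrization.
Context (K : fieldType) (n t : nat).
Implicit Types (m : 'X_{1..nsym n}) (p : {mpoly K[nsym n]}).

Definition yvar (k : 'I_t) (i : 'I_n) : 'I_(t * n) := mxvec_index k i.

Definition genY : 'M[{mpoly K[t * n]}]_(t, n) := \matrix_(k, i) 'X_(yvar k i).

Definition theta : {rmorphism {mpoly K[nsym n]} -> {mpoly K[t * n]}} :=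
  GRing.RMorphism.clone _ _ (mmap (@mpolyC (t * n) K)
    (fun v => \sum_k 'X_(yvar k (sympr v).1) * 'X_(yvar k (sympr v).2))) _.

Lemma thetaX v : theta 'X_v =
  \sum_k 'X_(yvar k (sympr v).1) * 'X_(yvar k (sympr v).2).
Proof. by rewrite /= mmapX mmap1U. Qed.

Lemma theta_symX : map_mx theta (symX K n) = genY^T *m genY.
Proof.
apply/matrixP => i j; rewrite !mxE thetaX.
under [RHS]eq_bigr => k _ do rewrite !mxE.
rewrite (sympr_eq (h := fun a b => \sum_k 'X_(yvar k a) * 'X_(yvar k b))) //.
by move=> a b; apply: eq_bigr => k _; rewrite mulrC.
Qed.

Lemma theta_det k (f g : 'I_k -> 'I_n) :
  theta (\det (mxsub f g (symX K n))) = \det ((colsub f genY)^T *m colsub g genY).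
Proof.
rewrite -det_map_mx map_mxsub theta_symX; congr determinant.
apply/matrixP => i j; rewrite !mxE; apply: eq_bigr => l _; by rewrite !mxE.
Qed.

Lemma theta_minors_ideal p : @minors_ideal K n t p -> theta p = 0.
Proof.
apply: (ideal_span_min (J := fun q => theta q = 0)) => [|_ [f [g [_ [_ ->]]]]].
  split; first exact: rmorph0.
  split=> [a b|r a]; first by rewrite rmorphD => -> ->; rewrite addr0.
  by rewrite rmorphM => ->; rewrite mulr0.
by rewrite theta_det det_low_rank.
Qed.

Lemma yvar_inj k k' i i' : yvar k i = yvar k' i' -> k = k' /\ i = i'.
Proof. by rewrite /yvar /mxvec_index => /cast_ord_inj /enum_rank_inj [-> ->]. Qed.

Section Initial.
Variable m0 : 'X_{1..nsym n}.
Hypothesis std0 : standard t m0.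

Let F := [set x : 'I_n * 'I_n | m0 (symvar x.1 x.2) != 0%N].
Let L k := layer k F.

Lemma symF : symset F.
Proof. by move=> x; rewrite !inE symvarC. Qed.

Lemma symL k : symset (L k). Proof. exact: layer_sym symF. Qed.

(** A point surviving [t] peelings starts a strict chain of [t.+1] positions in the support of [m0]:
    the main diagonal of a minor, which standardness forbids. *)
Lemma layer_standard : L t = set0.
Proof.
apply/eqP; rewrite -subset0; apply/subsetP => x xt; exfalso.
have [s [ps ss sF]] := layer_chain xt.
pose z (a : 'I_t.+1) := nth x (x :: s) a.
have sz (a : 'I_t.+1) : (a < size (x :: s))%N by rewrite /= ss.
have zinc (a b : 'I_t.+1) : (a < b)%N -> lt2 (z a) (z b).
  by apply: (sorted_ltn_nth (@lt2_trans n)) => //; rewrite inE sz.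
have [||a] := @std0 (fun a => (z a).1) (fun a => (z a).2).
- by move=> a b /zinc /andP [].
- by move=> a b /zinc /andP [].
have : z a \in F by apply: (allP sF); apply: mem_nth.
by rewrite inE => /eqP.
Qed.

Definition inrim v := [exists k : 'I_t, sympr v \in rim (L k)].

Lemma inrim_supp v : m0 v != 0%N -> inrim v.
Proof.
move=> mv; have [|k kt xk] := rim_cover (x := sympr v) layer_standard.
  by rewrite inE symvar_sympr.
by apply/existsP; exists (Ordinal kt).
Qed.

Definition yweight (u : 'I_(t * n)) : nat :=
  mxvec (\matrix_(k < t, i < n) (2 * rows (L k) i + (n * n - #|down (L k)|))%N) 0 u.

Lemma yweight_yvar k i :
  yweight (yvar k i) = (2 * rows (L k) i + (n * n - #|down (L k)|))%N.
Proof. by rewrite /yweight /yvar mxvecE mxE. Qed.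

(** This is [rows_le] doubled, with its constant moved to the left. As the rims are disjoint, at
    most one summand of [theta 'X_v] reaches the weight [symw v]. *)
Lemma yweight_pair k v :
  (yweight (yvar k (sympr v).1) + yweight (yvar k (sympr v).2) <= symw v
     ?= iff (sympr v \in rim (L k)))%N.
Proof.
have [h1 h2] := rows_le (sympr v) (symL (k := k)).
have h3 : (#|down (L k)| <= n * n)%N.
  by rewrite (leq_trans (max_card _)) // card_prod !card_ord.
rewrite !yweight_yvar /symw; split; first by nia.
rewrite -h2; apply/eqP/eqP; lia.
Qed.

(* The initial form of [theta 'X_v] for the weight [yweight]. *)
Definition xbar v : {mpoly K[t * n]} :=
  \sum_(k < t) if sympr v \in rim (L k)
               then 'X_(yvar k (sympr v).1) * 'X_(yvar k (sympr v).2) else 0.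

Definition rimexp v : 'X_{1..t * n} :=
  (\sum_(k < t) if sympr v \in rim (L k)
     then U_(yvar k (sympr v).1) + U_(yvar k (sympr v).2) else 0)%MM.

Lemma wlead_theta v : wlead yweight (symw v) (theta 'X_v) (xbar v).
Proof.
rewrite thetaX; apply: wlead_sum => k _; have [h1 h2] := yweight_pair k v.
have B : wlt yweight (yweight (yvar k (sympr v).1) + yweight (yvar k (sympr v).2)).+1
     ('X_(yvar k (sympr v).1) * 'X_(yvar k (sympr v).2) : {mpoly K[t * n]}).
  by rewrite -mpolyXD; apply: wltX; rewrite wtD !wtU.
case: ifP => xr; first by apply: wlead_refl; apply: wlt_mono B.
split; first exact: wlt_zero.
by rewrite subr0; apply: wlt_mono B; rewrite ltn_neqAle h2 xr.
Qed.

Lemma xbar_rim v : inrim v -> xbar v = 'X_[rimexp v].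
Proof.
move=> /existsP [k xk]; rewrite /xbar /rimexp (bigD1 k) //= [in RHS](bigD1 k) //= xk.
rewrite !big1; first by rewrite addr0 addm0 mpolyXD.
  by move=> l lk; case: ifP => // /(rim_disjoint xk) /val_inj E; rewrite E eqxx in lk.
by move=> l lk; case: ifP => // /(rim_disjoint xk) /val_inj E; rewrite E eqxx in lk.
Qed.

Lemma xbar_norim v : ~~ inrim v -> xbar v = 0.
Proof.
move=> /existsP H; apply: big1 => k _; case: ifP => // xk.
by case: H; exists k.
Qed.

Lemma wt_rimexp v : inrim v -> wt yweight (rimexp v) = symw v.
Proof.
move=> /existsP [k xk]; rewrite /rimexp (bigD1 k) //= xk big1.
  by rewrite addm0 wtD !wtU; have [_ e] := yweight_pair k v; apply/eqP; rewrite e.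
by move=> l lk; case: ifP => // /(rim_disjoint xk) /val_inj E; rewrite E eqxx in lk.
Qed.

Definition mrimexp m : 'X_{1..t * n} := (\sum_v rimexp v *+ m v)%MM.

Lemma wlead_thetaX m :
  wlead yweight (wt (@symw n) m) (theta 'X_[m]) (\prod_v xbar v ^+ m v).
Proof.
rewrite [in theta _]mpolyXE_id rmorph_prod; apply: wlead_prod => v _.
by rewrite rmorphXn; apply: wleadXn; apply: wlead_theta.
Qed.

Lemma mrimexpE m k i : mrimexp m (yvar k i) =
  (\sum_v m v * ((sympr v \in rim (L k)) *
     ((i == (sympr v).1) + (i == (sympr v).2))))%N.
Proof.
rewrite mnm_sumE; apply: eq_bigr => v _; rewrite mulmnE mulnC; congr (_ * _)%N.
have U (a b : 'I_n) (l : 'I_t) : U_(yvar l a)%MM (yvar k b) = ((l == k) && (b == a))%N.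
  rewrite mnm1E; congr nat_of_bool; apply/eqP/andP => [/yvar_inj [-> ->]//|].
  by move=> [/eqP -> /eqP ->].
rewrite mnm_sumE (bigD1 k) //= big1 ?addn0 => [|l lk].
  by case: ifP => _; rewrite ?mnm0E // mnmDE !U eqxx mul1n.
by case: ifP => _; rewrite ?mnm0E // mnmDE !U (negPf lk).
Qed.

(* A symmetric matrix supported on an antichain is determined by its row sums. *)
Lemma mrimexp_inj m m' : (forall v, m v != 0%N -> inrim v) ->
  (forall v, m' v != 0%N -> inrim v) -> mrimexp m = mrimexp m' -> m = m'.
Proof.
move=> hm hm' E; apply/mnmP => v0; apply/eqP; apply/negPn/negP => ne0.
have /existsP [k xk] : inrim v0.
  have [z|/hm//] := eqVneq (m v0) 0%N; apply: hm'.
  by apply: contra ne0 => /eqP ->; rewrite z.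
pose c v i := ((sympr v \in rim (L k)) * ((i == (sympr v).1) + (i == (sympr v).2)))%N.
(* The exponents of [yvar k i] agree, so a disagreement of [m] and [m'] in row [i] of the rim
   entails a second one in the same row. *)
have other v i : c v i != 0%N -> m v != m' v ->
    exists v', [/\ v' != v, c v' i != 0%N & m v' != m' v'].
  move=> cv mv; apply: boolp.contrapT => H.
  have := congr1 (fun e : 'X_{1..t * n} => e (yvar k i)) E.
  rewrite /= !mrimexpE (bigD1 v) //= [in RHS](bigD1 v) //=.
  rewrite (eq_bigr (fun v' => m' v' * c v' i)%N) => [/addIn /eqP|v' v'v].
    by rewrite eqn_mul2r -/(c v i) (negPf cv) (negPf mv).
  rewrite -/(c v' i); have [->|cv'] := eqVneq (c v' i) 0%N; first by rewrite !muln0.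
  by congr (_ * _)%N; apply/eqP/negPn/negP => mv'; apply: H; exists v'.
pose D := [set x in rim (L k) | m (symvar x.1 x.2) != m' (symvar x.1 x.2)].
have symR := rim_sym (symL (k := k)).
have sD x : x \in D -> swap2 x \in D.
  by rewrite inE => /andP [xr xm]; rewrite inE symR //= symvarC.
have next i j : (i, j) \in D -> exists2 j', (i, j') \in D & j' != j.
  rewrite inE /= => /andP [xr xm].
  have xr' : sympr (symvar i j) \in rim (L k).
    by rewrite sympr_symvar; case: (sympair_cases i j) => -> //; apply: (symR (i, j)).
  have [|v [vv cv mv]] := other (symvar i j) i _ xm.
    rewrite /c xr' mul1n sympr_symvar.
    by case: (sympair_cases i j) => -> /=; rewrite eqxx // addn1.
  move: cv; rewrite /c; case: (boolP (sympr v \in _)) => // vr.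
  rewrite mul1n addn_eq0 negb_and !eqb0 !negbK => /orP [] /eqP ei.
    exists (sympr v).2; first by rewrite ei inE /= -surjective_pairing vr symvar_sympr.
    by apply: contra vv => /eqP <-; rewrite ei symvar_sympr.
  exists (sympr v).1.
    by rewrite ei inE /= symvarC symvar_sympr mv andbT; apply: (symR (sympr v)).
  by apply: contra vv => /eqP <-; rewrite ei symvarC symvar_sympr.
have x0D : sympr v0 \in D by rewrite inE xk symvar_sympr.
(* Take the smallest row [i] met by [D], and in it the largest column [j]. The second disagreements,
   in row [i] to the left and in column [j] below, are strictly comparable, which the antichain
   excludes. *)
have [[i j'] iD imin] := arg_minnP (fun x : 'I_n * 'I_n => val x.1) x0D.
have [j jD jmax] := arg_maxnP (P := fun j => (i, j) \in D) (fun j : 'I_n => val j) iD.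
have [j1 j1D j1j] := next i j jD.
have [i2 i2D i2i] := next j i (sD _ jD).
have i2D' := sD _ i2D.
have lt1 : (j1 < j)%N by rewrite ltn_neqAle j1j; apply: jmax.
have lt2' : (i < i2)%N by rewrite ltn_neqAle eq_sym i2i; apply: (imin _ i2D').
have DR x : x \in D -> x \in rim (L k) by rewrite in_set => /andP [].
by case/negP: (rim_antichain (DR _ j1D) (DR _ i2D')); rewrite /lt2 /= lt1 lt2'.
Qed.

Lemma xbar_coeff m : (\prod_v xbar v ^+ m v)@_(mrimexp m0) = (m == m0)%:R.
Proof.
have [/existsP [v /andP [mv vr]]|/existsP H] := boolP [exists v, (m v != 0%N) && ~~ inrim v].
  rewrite (bigD1 v) //= xbar_norim // expr0n (negPf mv) mul0r mcoeff0.
  have [E|//] := eqVneq m m0; rewrite E in mv.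
  by case/negP: vr; apply: inrim_supp.
have hm v : m v != 0%N -> inrim v.
  by move=> mv; apply: contraT => vr; case: H; exists v; apply/andP.
rewrite (eq_bigr (fun v => 'X_[rimexp v] ^+ m v)) => [|v _]; last first.
  have [->|/hm /xbar_rim -> //] := eqVneq (m v) 0%N; by rewrite !expr0.
rewrite mprodXnE mcoeffX; congr (_%:R); congr nat_of_bool.
apply/eqP/eqP => [|->//]; apply: mrimexp_inj => //; exact: inrim_supp.
Qed.

Lemma wt_mrimexp : wt yweight (mrimexp m0) = wt (@symw n) m0.
Proof.
rewrite /mrimexp wt_sum; apply: eq_bigr => v _; rewrite wtMn.
have [->//|/inrim_supp /wt_rimexp -> //] := eqVneq (m0 v) 0%N.
Qed.

End Initial.

(** Choose [m0] of maximal weight in the support of [p] and the weight adapted to it. At the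
    exponent [mrimexp m0 m0] only leading forms matter, and among them only that of [m0]
    contributes. *)
Lemma theta_standard_inj p : standardp t p -> theta p = 0 -> p = 0.
Proof.
move=> sp tp; apply/eqP; rewrite -msupp_eq0; apply/negPn/negP => /exists_max_seq H.
have [m0 m0p mmax] := H (wt (@symw n)).
have s0 : standard t m0 by apply: sp; rewrite -mcoeff_msupp.
have: (theta p)@_(mrimexp m0 m0) = p@_m0.
  rewrite [p in theta p]mpolyE rmorph_sum /= raddf_sum /=.
  rewrite (eq_big_seq (fun m => p@_m * (m == m0)%:R)) => [|m mp].
    rewrite (bigD1_seq m0) //= eqxx mulr1 big1 ?addr0 // => m /negPf ->.
    by rewrite mulr0.
  rewrite -mul_mpolyC -[mmap _ _ _]/(theta _) rmorphM /= mmapC mcoeffCM.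
  rewrite -[mmap _ _ _]/(theta 'X_[m]) (wlead_coeff (wlead_thetaX m0 m)).
    by rewrite xbar_coeff.
  by rewrite wt_mrimexp // mmax.
by rewrite tp mcoeff0 => /esym /eqP; rewrite mcoeff_eq0 m0p.
Qed.

Lemma theta_ker p : theta p = 0 <-> @minors_ideal K n t p.
Proof.
split; last exact: theta_minors_ideal.
have [g [sg Ig]] := straighten t p; move=> tp.
have : theta g = 0.
  by have := theta_minors_ideal Ig; rewrite rmorphB tp sub0r => /eqP; rewrite oppr_eq0 => /eqP.
by move/(theta_standard_inj sg) => g0; rewrite g0 subr0 in Ig.
Qed.

End Parametrization.

(** * Frobenius traces *)

Section Semilinear.
Context (K : fieldType) (q : nat).
Hypotheses (q_gt0 : (0 < q)%N) (frobD : forall a b : K, (a + b) ^+ q = a ^+ q + b ^+ q).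
Implicit Types (a b x y : K) (G : K * K -> Prop).

(* The graph of a [K^q]-linear partial map sending [a ^+ q] to [a]. *)
Definition root_graph G : Prop :=
  [/\ forall a, G (a ^+ q, a),
      forall x y x' y', G (x, y) -> G (x', y') -> G (x + x', y + y'),
      forall a x y, G (x, y) -> G (a ^+ q * x, a * y) &
      forall y, G (0, y) -> y = 0].

Lemma frob0 : (0 : K) ^+ q = 0.
Proof. by rewrite expr0n eqn0Ngt q_gt0. Qed.

Lemma frobN a : (- a) ^+ q = - a ^+ q.
Proof.
by apply/eqP; rewrite -addr_eq0 -frobD addNr frob0.
Qed.

Lemma root_graph_functional G x y y' : root_graph G -> G (x, y) -> G (x, y') -> y = y'.
Proof.
move=> [G1 GD GZ G0] h h'; apply/eqP; rewrite -subr_eq0; apply/eqP/G0.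
have := GD _ _ _ _ h (GZ (-1) _ _ h').
by rewrite frobN expr1n !mulN1r subrr.
Qed.

(** A relation [0 = u + a ^+ q * x] with [a] nonzero would give [x = (- a^-1) ^+ q * u], which is
    already in the domain. *)
Lemma root_graph_extend G x : root_graph G -> ~ (exists y, G (x, y)) ->
  root_graph (fun z => exists u a, G (u, z.2) /\ z.1 = u + a ^+ q * x).
Proof.
move=> [G1 GD GZ G0] nx; split.
- by move=> a; exists (a ^+ q), 0; rewrite frob0 mul0r addr0.
- move=> x1 y x2 y' [u [a [h /= ->]]] [u' [a' [h' /= ->]]]; exists (u + u'), (a + a').
  by split; [apply: GD | rewrite frobD; ring].
- move=> b x1 y [u [a [h /= ->]]]; exists (b ^+ q * u), (b * a).
  by split; [apply: GZ | rewrite /= exprMn; ring].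
- move=> y [u [a [/= h E]]].
  have [a0|a0] := eqVneq a 0.
    by move: E h; rewrite a0 frob0 mul0r addr0 => <-; apply: G0.
  case: nx; exists (- a^-1 * y).
  have -> : x = (- a^-1) ^+ q * u.
    have -> : u = - (a ^+ q * x) by apply/eqP; rewrite -addr_eq0 -E.
    by rewrite frobN mulNr mulrN opprK exprVn mulKf // expf_neq0.
  exact: GZ.
Qed.

Lemma exists_root_map : exists k : K -> K,
  [/\ forall x y, k (x + y) = k x + k y,
      forall a x, k (a ^+ q * x) = a * k x & k 1 = 1].
Proof.
pose G0 (z : K * K) := z.1 = z.2 ^+ q.
(* Adjoining [G0] makes the union of the empty chain admissible. *)
pose U (A : K * K -> Prop) z := A z \/ G0 z.
have gG0 : root_graph G0.
  split; rewrite /G0 //=.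
  - by move=> x y x' y' -> ->; rewrite frobD.
  - by move=> a x y ->; rewrite exprMn.
  - by move=> y /esym /eqP; rewrite expf_eq0 => /andP [_ /eqP].
have ext (G G' : K * K -> Prop) : (forall z, G z <-> G' z) -> root_graph G -> root_graph G'.
  move=> E [h1 h2 h3 h4]; split.
  - by move=> a; apply/E/h1.
  - by move=> x y x' y' /E g /E g'; apply/E/h2.
  - by move=> a x y /E g; apply/E/h3.
  - by move=> y /E /h4.
have [F FP Ftot|A [PA Amax]] := @classical_sets.Zorn_bigcup _ (fun A => root_graph (U A)).
  have pick z z' : U (classical_sets.bigcup F id) z -> U (classical_sets.bigcup F id) z' ->
      exists G, [/\ root_graph G, G z, G z' & forall z'', G z'' ->
                   U (classical_sets.bigcup F id) z''].
    have sub X z'' : F X -> U X z'' -> U (classical_sets.bigcup F id) z''.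
      by move=> FX [Xz|]; [left; exists X | right].
    case=> [[X FX Xz]|g] [[X' FX' Xz']|g'].
    - have [h|h] := Ftot _ _ FX FX'.
        by exists (U X'); split; [exact: FP | left; exact: h | left | move=> ?; apply: sub].
      by exists (U X); split; [exact: FP | left | left; exact: h | move=> ?; apply: sub].
    - by exists (U X); split; [exact: FP | left | right | move=> ?; apply: sub].
    - by exists (U X'); split; [exact: FP | right | left | move=> ?; apply: sub].
    - by exists G0; split=> // z'' ?; right.
  split.
  - by move=> a; right.
  - move=> x y x' y' /pick h /h [G [[_ GD _ _] g g' sub]]; exact/sub/GD.
  - by move=> a x y h; have [G [[_ _ GZ _] g _ sub]] := pick _ _ h h; exact/sub/GZ.
  - by move=> y h; have [G [[_ _ _ G00] g _ _]] := pick _ _ h h; exact: G00.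
have tot x : exists y, U A (x, y).
  apply: boolp.contrapT => nx; pose G' := fun z : K * K => exists u a, U A (u, z.2) /\ z.1 = u + a ^+ q * x.
  have AG z : U A z -> G' z.
    move=> h; exists z.1, 0; rewrite -surjective_pairing frob0.
    by rewrite mul0r addr0.
  have z0 : U A (0, 0) by right; rewrite /G0 /= frob0.
  apply: (Amax G').
    split=> [z Az|sub]; first by apply: AG; left.
    apply: nx; exists 0; left; apply: sub; exists 0, 1; split=> //=.
    by rewrite expr1n mul1r add0r.
  apply: (ext G'); last exact: root_graph_extend.
  by move=> z; split=> [|[//|g]]; [left | apply: AG; right].
have [k hk] := boolp.choice tot; exists k; have [U1 UD UZ _] := PA.
split=> [x y|a x|].
- by apply: (root_graph_functional PA (hk _)); exact: (UD _ _ _ _ (hk x) (hk y)).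
- by apply: (root_graph_functional PA (hk _)); exact: (UZ a _ _ (hk x)).
- by apply: (root_graph_functional PA (hk _)); move: (U1 1); rewrite expr1n.
Qed.

End Semilinear.

Section Trace.
Context (K : fieldType) (N q : nat) (k : K -> K).
Hypotheses (q_gt0 : (0 < q)%N).
Hypothesis frobS : forall a b : {mpoly K[N]}, (a + b) ^+ q = a ^+ q + b ^+ q.
Hypotheses (kD : forall x y, k (x + y) = k x + k y)
  (kZ : forall a x, k (a ^+ q * x) = a * k x).
Implicit Types (p r s : {mpoly K[N]}) (m : 'X_{1..N}).

Definition troot m : 'X_{1..N} := [multinom (m i * q + q.-1)%N | i < N].

(* Semilinear over Frobenius, sending [c x^(q m + q - 1)] to [k c x^m] and the
   other monomials to [0]. *)
Definition trace p : {mpoly K[N]} :=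
  \sum_(m : 'X_{1..N < msize p}) k p@_(troot m) *: 'X_[m].

Lemma semilinear0 : k 0 = 0.
Proof. by apply: (addrI (k 0)); rewrite -kD !addr0. Qed.

(** The cut-off in the sum defining [trace] is harmless: [troot m] has at least the degree of [m],
    so both sides vanish when [mdeg m] is at least [msize p]. *)
Lemma trace_coeff p m : (trace p)@_m = k p@_(troot m).
Proof.
have [lt|ge] := ltnP (mdeg m) (msize p); first exact: (mcoeff_mpoly (fun m' => k p@_(troot m')) lt).
rewrite /trace raddf_sum big1 => [|m' _].
  rewrite (_ : p@_(troot m) = 0) ?semilinear0 //; apply/memN_msupp_eq0/msize_mdeg_ge.
  apply: leq_trans ge _; rewrite !mdegE; apply: leq_sum => i _.
  by rewrite mnmE (leq_trans _ (leq_addr _ _)) // leq_pmulr.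
rewrite /= mcoeffZ mcoeffX; have [E|] := eqVneq (val m') m; last by rewrite mulr0.
by have := bmdeg m'; rewrite E ltnNge ge.
Qed.

Lemma traceD p r : trace (p + r) = trace p + trace r.
Proof. by apply/mpolyP => m; rewrite mcoeffD !trace_coeff mcoeffD kD. Qed.

Lemma trace0 : trace 0 = 0.
Proof. by apply/mpolyP => m; rewrite trace_coeff !mcoeff0 semilinear0. Qed.

Lemma trace_sum (I : Type) (l : seq I) (P : pred I) (F : I -> {mpoly K[N]}) :
  trace (\sum_(i <- l | P i) F i) = \sum_(i <- l | P i) trace (F i).
Proof. exact: (big_morph trace traceD trace0). Qed.

Lemma mcoeffMX_not_le p m m' : ~~ (m <= m')%MM -> (p * 'X_[m])@_m' = 0.
Proof.
move=> h; rewrite mcoeffM big1 // => x /eqP E; rewrite mcoeffX.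
have [E'|] := eqVneq m (val x.2); last by rewrite mulr0.
by case/negP: h; rewrite E E' lem_addl.
Qed.

Lemma trace_semilinear r s : trace (r ^+ q * s) = r * trace s.
Proof.
move: r; apply: mpolyind => [|c m r _ _ IH].
  by rewrite expr0n eqn0Ngt q_gt0 !mul0r trace0.
rewrite frobS !mulrDl traceD IH; congr (_ + _); apply/mpolyP => m'.
have -> : (c *: 'X_[m]) ^+ q * s = c ^+ q *: (s * 'X_[m *+ q]).
  by rewrite exprZn mpolyXn -scalerAl mulrC.
have -> : c *: 'X_[m] * trace s = c *: (trace s * 'X_[m]) by rewrite -scalerAl mulrC.
rewrite trace_coeff !mcoeffZ kZ; congr (_ * _).
have [le|nle] := boolP (m <= m')%MM.
  rewrite -(submK le) addmC; set d := (m' - m)%MM.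
  rewrite (mcoeffMX (trace s) m d) trace_coeff; congr k.
  rewrite -(mcoeffMX s (m *+ q) (troot d)); congr (_@_ _).
  apply/mnmP => i; rewrite [RHS]mnmDE mulmnE ![troot _ i]mnmE mnmDE.
  by rewrite mulnDl addnA.
rewrite !mcoeffMX_not_le ?semilinear0 //.
apply: contra nle => /mnm_lepP h; apply/mnm_lepP => i; have := h i.
rewrite mulmnE mnmE => h'; rewrite leqNgt.
by apply/negP => lt; move: q_gt0 h' lt; nia.
Qed.

End Trace.

(** * Inverting the principal minor *)

Lemma ideal_spanMM (R : comPzRingType) (S S' S'' : R -> Prop) a b :
  (forall x y, S x -> S' y -> S'' (x * y)) ->
  ideal_span S a -> ideal_span S' b -> ideal_span S'' (a * b).
Proof.
move=> SS [s [hs ->]] [s' [hs' ->]]; rewrite big_distrl big_seq.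
apply: ideal_span_sum => x xs; rewrite big_distrr big_seq; apply: ideal_span_sum => y ys.
by rewrite /= mulrACA; apply/ideal_spanM/ideal_span_gen/SS; [apply: hs | apply: hs'].
Qed.

Lemma ideal_span_sub (R : comPzRingType) (S S' : R -> Prop) :
  (forall x, S x -> ideal_span S' x) -> forall x, ideal_span S x -> ideal_span S' x.
Proof.
move=> SS; apply: ideal_span_min => //; split; first exact: ideal_span0.
by split=> *; [apply: ideal_spanD | apply: ideal_spanM].
Qed.

Section IdealPowers.
Context (R : comPzRingType) (V : finType) (B : pred V) (z : V -> R).

(** Degree at least [d] generates the same ideal power as degree exactly [d], and makes monotonicity
    in [d] immediate. *)
Definition ipow_gen d x : Prop :=
  exists2 e : V -> nat, (d <= \sum_(v | B v) e v)%N & x = \prod_(v | B v) z v ^+ e v.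

Definition ipow d : R -> Prop := ideal_span (ipow_gen d).

Lemma ipow_gen0 d e x : (d <= e)%N -> ipow_gen e x -> ipow_gen d x.
Proof. by move=> de [u h ->]; exists u => //; apply: leq_trans h. Qed.

Lemma ipow_le d e x : (d <= e)%N -> ipow e x -> ipow d x.
Proof.
by move=> de; apply: ideal_span_sub => y /(ipow_gen0 de); apply: ideal_span_gen.
Qed.

Lemma ipow0 x : ipow 0 x.
Proof.
rewrite -[x]mulr1; apply/ideal_spanM/ideal_span_gen; exists (fun=> 0%N) => //.
by rewrite big1.
Qed.

Lemma ipowM d e x y : ipow d x -> ipow e y -> ipow (d + e) (x * y).
Proof.
apply: ideal_spanMM => _ _ [u hu ->] [v hv ->]; exists (fun i => u i + v i)%N.
  by rewrite big_split leq_add.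
by rewrite -big_split; apply: eq_bigr => i _; rewrite exprD.
Qed.

Lemma ipow_gen_z v : B v -> ipow 1 (z v).
Proof.
move=> Bv; apply: ideal_span_gen; exists (fun i => (i == v)%N).
  by rewrite (bigD1 v) //= eqxx.
rewrite (bigD1 v) //= eqxx expr1 big1 ?mulr1 // => i /andP [_ /negPf ->].
by rewrite expr0.
Qed.

Lemma ipowXn d x k : ipow d x -> ipow (k * d) (x ^+ k).
Proof.
move=> h; elim: k => [|k IH]; first exact: ipow0.
by rewrite exprS mulSn; apply: ipowM.
Qed.

Lemma ipow_prod (I : Type) (r : seq I) (P : pred I) (d : I -> nat) (F : I -> R) :
  (forall i, P i -> ipow (d i) (F i)) ->
  ipow (\sum_(i <- r | P i) d i) (\prod_(i <- r | P i) F i).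
Proof.
move=> H; elim/big_rec2: _ => [|i x y Pi]; first exact: ipow0.
exact/ipowM/H.
Qed.

Definition frob_gen q x : Prop := exists2 v, B v & x = z v ^+ q.

(** Pigeonhole: in a monomial of such a degree some [z v] has exponent at least [q]. *)
Lemma ipow_frob q x : (0 < q)%N ->
  ipow (\sum_(v | B v) q.-1).+1 x -> ideal_span (frob_gen q) x.
Proof.
move=> q0; apply: ideal_span_sub => _ [e he ->].
have [/existsP [v /andP [Bv qv]]|/existsP H] := boolP [exists v, B v && (q <= e v)%N].
  rewrite (bigD1 v) //= -(subnK qv) exprD mulrAC; apply/ideal_spanM/ideal_span_gen.
  by exists v.
move: he; rewrite ltnNge => /negP; case; apply: leq_sum => v Bv.
rewrite -ltnS prednK // ltnNge; apply/negP => qv; apply: H.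
by exists v; rewrite Bv.
Qed.

End IdealPowers.

Section Elimination.
Context (K : fieldType) (n' t : nat).
Local Notation n := n'.+1.
Local Notation S := {mpoly K[nsym n]}.
Local Notation X := (symX K n).
Local Notation theta := (theta K n t).
Implicit Types (p a s : S) (v : 'I_(nsym n)).

Definition lo k (i : 'I_k) : 'I_n := inord i.
Definition hi k (i : 'I_k) : 'I_n := inord (i + (n - k)).

Lemma loE k (i : 'I_k) : (k <= n)%N -> lo i = i :> nat.
Proof. by move=> kn; rewrite inordK // (leq_trans (ltn_ord i)). Qed.

Lemma hiE k (i : 'I_k) : (k <= n)%N -> hi i = (i + (n - k))%N :> nat.
Proof. by move=> kn; rewrite inordK //; have := ltn_ord i; lia. Qed.

Lemma lo_inc k : (k <= n)%N -> increasing (@lo k).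
Proof. by move=> kn a b ab; rewrite !loE. Qed.

Lemma hi_inc k : (k <= n)%N -> increasing (@hi k).
Proof. by move=> kn a b ab; rewrite !hiE // ltn_add2r. Qed.

Hypothesis tn : (t < n)%N.

Definition low v : bool := (t <= (sympr v).1)%N.
Definition lowdeg v : nat := low v.

(* Polynomials in the entries of the first [t] rows of [X]. *)
Definition topp p : Prop := wlt lowdeg 1 p.

Lemma toppD p q : topp p -> topp q -> topp (p + q). Proof. exact: wltD. Qed.
Lemma toppM p q : topp p -> topp q -> topp (p * q).
Proof. by move=> hp hq; apply: (wltM (d := 0)). Qed.
Lemma toppC c : topp c%:MP. Proof. exact: wltC. Qed.
Lemma topp1 : topp 1. Proof. by rewrite -mpolyC1; apply: toppC. Qed.
Lemma toppN p : topp p -> topp (- p). Proof. exact: wltN. Qed.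

Lemma toppXn p k : topp p -> topp (p ^+ k).
Proof.
by move=> h; elim: k => [|k IH]; rewrite ?expr0 ?exprS; [apply: topp1 | apply: toppM].
Qed.

Lemma topp_sign (b : nat) : topp ((-1) ^+ b).
Proof. by apply/toppXn/toppN/topp1. Qed.

Lemma topp_det k (M : 'M[S]_k) : (forall i j, topp (M i j)) -> topp (\det M).
Proof.
move=> h; rewrite /determinant; apply: wlt_sum => u _; apply: toppM.
  exact: topp_sign.
by elim/big_ind: _ => //; [exact: topp1 | exact: toppM].
Qed.

Lemma topp_mulmx k l m (M : 'M[S]_(k, l)) (M' : 'M[S]_(l, m)) :
  (forall i j, topp (M i j)) -> (forall i j, topp (M' i j)) ->
  forall i j, topp ((M *m M') i j).
Proof. by move=> h h' i j; rewrite mxE; apply: wlt_sum => u _; apply: toppM. Qed.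

Lemma topp_adj k (M : 'M[S]_k) :
  (forall i j, topp (M i j)) -> forall i j, topp ((\adj M) i j).
Proof.
move=> h i j; rewrite mxE /cofactor; apply: toppM; first exact: topp_sign.
by apply: topp_det => a b; rewrite !mxE.
Qed.

Lemma topp_symX i (k : 'I_t) : topp (X i (lo k)).
Proof.
rewrite mxE; apply: wltX; rewrite wtU /lowdeg /low ltnS leqn0 eqb0 -ltnNge.
have kt : (lo k < t)%N by rewrite loE // ltnW.
rewrite sympr_symvar; have := sympair_le i (lo k).
by case: (sympair_cases i (lo k)) => -> //= h; apply: leq_ltn_trans kt.
Qed.

(** Such a polynomial is standard: the last diagonal entry of a minor of size [t.+1] has both
    indices at least [t], so its variable is low. *)
Lemma topp_theta_inj a : topp a -> theta a = 0 -> a = 0.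
Proof.
move=> ha; apply: theta_standard_inj => m am f g hf hg; exists ord_max.
have ge_id (u : 'I_t.+1 -> 'I_n) : increasing u -> (t <= u ord_max)%N.
  move=> hu; have H k (kt : (k < t.+1)%N) : (k <= u (Ordinal kt))%N.
    elim: k kt => // k IH kt; apply: leq_ltn_trans (IH (ltnW kt)) _.
    exact: hu.
  by apply: leq_trans (H t (ltnSn t)) _; rewrite (_ : Ordinal _ = ord_max) //; apply: val_inj.
set v := symvar _ _.
have lv : low v.
  by rewrite /low sympr_symvar; case: (sympair_cases (f ord_max) (g ord_max)) => -> /=; exact: ge_id.
have w0 : wt lowdeg m = 0%N.
  by apply/eqP; rewrite -leqn0 -ltnS ltnNge; apply: contra am => /ha ->.
move: w0; rewrite /wt => /eqP; rewrite sum_nat_eq0 => /forallP /(_ v) /=.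
by rewrite /lowdeg lv muln1 => /eqP.
Qed.

Definition P0 : 'M[S]_t := mxsub (@lo t) (@lo t) X.
Definition delta0 : S := \det P0.
Definition cols0 : 'M[S]_(n, t) := colsub (@lo t) X.
(** This is [delta0] times the Schur complement of [P0], written without division. Its entries at
    low positions are the minors of size [t.+1] bordering [P0]. *)
Definition Zmx : 'M[S]_n := delta0 *: X - cols0 *m \adj P0 *m cols0^T.
Definition zvar v : S := Zmx (sympr v).1 (sympr v).2.

Lemma symX_sym : X^T = X.
Proof. by apply/matrixP => i j; rewrite !mxE symvarC. Qed.

Lemma P0_sym : P0^T = P0.
Proof. by rewrite /P0 trmx_mxsub symX_sym. Qed.

Lemma Zmx_sym : Zmx^T = Zmx.
Proof.
rewrite /Zmx linearB linearZ /= symX_sym !trmx_mul trmxK trmx_adj P0_sym.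
by rewrite mulmxA.
Qed.

Lemma Zmx_symC i j : Zmx i j = Zmx j i.
Proof. by rewrite -[in LHS]Zmx_sym mxE. Qed.

Lemma Zmx_top (i j : 'I_n) : (i < t)%N -> Zmx i j = 0.
Proof.
move=> it; pose i' := Ordinal it.
have iE : i = lo i' by apply: val_inj; rewrite /= loE // ltnW.
have : row i (cols0 *m \adj P0) = delta0 *: row i' 1%:M.
  rewrite row_mul (_ : row i cols0 = row i' P0).
    by rewrite -row_mul mul_mx_adj -[(\det P0)%:M]scalemx1 linearZ.
  by apply/matrixP => a b; rewrite !mxE iE.
move=> E; suff -> : Zmx i j = (delta0 *: row i X - row i (cols0 *m \adj P0) *m cols0^T) 0 j.
  rewrite E -scalemxAl -row_mul mul1mx.
  by rewrite !mxE -iE symvarC subrr.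
by rewrite -row_mul !mxE; congr (_ - _); rewrite !mxE.
Qed.

Lemma Zmx_low (i j : 'I_n) : ~~ low (symvar i j) -> Zmx i j = 0.
Proof.
rewrite /low sympr_symvar -ltnNge.
by case: (sympair_cases i j) => -> /= h; [|rewrite Zmx_symC]; apply: Zmx_top.
Qed.

Lemma zvar_symvar (i j : 'I_n) : zvar (symvar i j) = Zmx i j.
Proof. by rewrite /zvar (sympr_eq (h := fun a b : 'I_n => Zmx a b)) //; apply: Zmx_symC. Qed.

Lemma topp_delta0 : topp delta0.
Proof. by apply: topp_det => i j; rewrite mxE; apply: topp_symX. Qed.

Lemma zvar_split v : exists2 a, topp a & zvar v = delta0 * 'X_v - a.
Proof.
exists ((cols0 *m \adj P0 *m cols0^T) (sympr v).1 (sympr v).2).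
  have h i j : topp (cols0 i j) by rewrite mxE; apply: topp_symX.
  apply: topp_mulmx => i j; last by rewrite mxE.
  apply: topp_mulmx => // a b; apply: topp_adj => c d; rewrite mxE; exact: topp_symX.
by rewrite /zvar !mxE symvar_sympr.
Qed.

Lemma delta0_neq0 : delta0 != 0.
Proof.
have inc := lo_inc (ltnW tn); pose dg := (\sum_a U_(symvar (@lo t a) (@lo t a)))%MM.
have wdg : (\sum_a symw (symvar (@lo t a) (@lo t a)) <= wt (@symw n) dg)%N.
  by rewrite wt_sum; apply: eq_leq; apply: eq_bigr => a _; rewrite wtU.
have := wlead_coeff (wlead_minor K inc inc) wdg.
rewrite mprodXE mcoeffX eqxx => d1; apply/eqP => d0; move: d1.
by rewrite -/P0 -/delta0 d0 mcoeff0 => /eqP; rewrite eq_sym oner_eq0.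
Qed.

Lemma theta_delta0_neq0 : theta delta0 != 0.
Proof. by apply/eqP => /(topp_theta_inj topp_delta0) /eqP; rewrite (negPf delta0_neq0). Qed.

Lemma theta_delta0_cancel N a : theta (delta0 ^+ N * a) = 0 -> theta a = 0.
Proof.
rewrite rmorphM rmorphXn => /eqP; rewrite mulf_eq0 expf_eq0 (negPf theta_delta0_neq0).
by rewrite andbF => /eqP.
Qed.

Lemma theta_zvar v : theta (zvar v) = 0.
Proof.
pose Y := genY K n t; pose Y1 : 'M_t := colsub (@lo t) Y.
have thP : map_mx theta P0 = Y1^T *m Y1.
  rewrite /P0 map_mxsub theta_symX; apply/matrixP => i j; rewrite !mxE.
  by apply: eq_bigr => l _; rewrite !mxE.
have thd : theta delta0 = \det (Y1^T *m Y1) by rewrite -thP det_map_mx.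
have thC : map_mx theta cols0 = Y^T *m Y1.
  rewrite /cols0 map_mxsub theta_symX; apply/matrixP => i j; rewrite !mxE.
  by apply: eq_bigr => l _; rewrite !mxE.
(* The image of [Zmx] is this matrix between [Y^T] and [Y]. It is killed by [Y1^T] on the left, and
   [\det Y1] is nonzero since its square is the image of [delta0]. *)
have E0 : theta delta0 *: 1%:M - Y1 *m \adj (Y1^T *m Y1) *m Y1^T = 0.
  set E := _ - _; have YE : Y1^T *m E = 0.
    rewrite mulmxBr -scalemxAr mulmx1 !mulmxA mul_mx_adj -thd mul_scalar_mx subrr //.
  have : \det Y1 *: E = 0.
    by rewrite -det_tr -mul_scalar_mx -mul_adj_mx -mulmxA YE mulmx0.
  move/matrixP => h; apply/matrixP => i j; have /eqP := h i j; rewrite !mxE mulf_eq0.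
  case/orP => /eqP // d0; have := theta_delta0_neq0.
  by rewrite thd det_mulmx d0 mulr0 eqxx.
suff /matrixP /(_ (sympr v).1 (sympr v).2) : map_mx theta Zmx = 0.
  by rewrite mxE [RHS]mxE.
rewrite /Zmx map_mxB map_mxZ !map_mxM -map_trmx map_mx_adj thP thC theta_symX.
have -> : theta delta0 *: (Y^T *m Y) - Y^T *m Y1 *m \adj (Y1^T *m Y1) *m (Y^T *m Y1)^T =
   Y^T *m (theta delta0 *: 1%:M - Y1 *m \adj (Y1^T *m Y1) *m Y1^T) *m Y.
  by rewrite trmx_mul trmxK mulmxBr mulmxBl -scalemxAr mulmx1 -scalemxAl !mulmxA.
by rewrite E0 mulmx0 mul0mx.
Qed.

Local Notation zpow := (ipow low zvar).

(** Once [delta0] is inverted, [zvar_split] solves for each low variable modulo the [zvar v]. *)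
Lemma eliminate s : exists N a, topp a /\ zpow 1 (delta0 ^+ N * s - a).
Proof.
move: s; apply: mpoly_subring_ind => [c|v|p q [N [a [ha hp]]] [M [b [hb hq]]]
                                     |p q [N [a [ha hp]]] [M [b [hb hq]]]].
- exists 0%N, c%:MP; split; first exact: toppC.
  by rewrite expr0 mul1r subrr; apply: ideal_span0.
- have [lv|lv] := boolP (low v).
    have [a ha zE] := zvar_split v; exists 1%N, a; split=> //.
    by rewrite expr1 -zE; apply: ipow_gen_z.
  exists 0%N, 'X_v; split; last by rewrite expr0 mul1r subrr; apply: ideal_span0.
  by apply: wltX; rewrite wtU /lowdeg (negPf lv).
- exists (N + M)%N, (delta0 ^+ M * a + delta0 ^+ N * b); split.
    by apply: toppD; apply: toppM => //; apply/toppXn/topp_delta0.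
  have -> : delta0 ^+ (N + M) * (p + q) - (delta0 ^+ M * a + delta0 ^+ N * b) =
    delta0 ^+ M * (delta0 ^+ N * p - a) + delta0 ^+ N * (delta0 ^+ M * q - b).
    by rewrite exprD; ring.
  by apply: ideal_spanD; apply: ideal_spanM.
- exists (N + M)%N, (a * b); split; first exact: toppM.
  have -> : delta0 ^+ (N + M) * (p * q) - a * b =
    delta0 ^+ N * p * (delta0 ^+ M * q - b) + b * (delta0 ^+ N * p - a).
    by rewrite exprD; ring.
  by apply: ideal_spanD; apply: ideal_spanM.
Qed.

Lemma zpow_theta s : zpow 1 s -> theta s = 0.
Proof.
apply: (ideal_span_min (J := fun s => theta s = 0)) => [|_ [e he ->]].
  split; first exact: rmorph0.
  split=> [a b|r a]; first by rewrite rmorphD => -> ->; rewrite addr0.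
  by rewrite rmorphM => ->; rewrite mulr0.
have [v lv ev] : exists2 v, low v & (0 < e v)%N.
  apply: boolp.contrapT => H; move: he; rewrite big1 // => v lv; apply/eqP.
  by rewrite -leqn0 leqNgt; apply/negP => ev; apply: H; exists v.
by rewrite (bigD1 v) //= rmorphM rmorphXn theta_zvar expr0n gtn_eqF // mul0r.
Qed.

(** The polynomial in the top rows left by elimination is in the kernel, hence zero. So the [zvar v]
    generate the kernel after inverting [delta0]. *)
Lemma theta_zpow s : theta s = 0 -> exists N, zpow 1 (delta0 ^+ N * s).
Proof.
move=> s0; have [N [a [ha h]]] := eliminate s; exists N.
have := zpow_theta h; rewrite rmorphB rmorphM s0 mulr0 sub0r => /eqP.
by rewrite oppr_eq0 => /eqP /(topp_theta_inj ha) a0; rewrite a0 subr0 in h.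
Qed.

End Elimination.

(** * Compatible trace maps *)

Section Descent.
Context (K : fieldType) (n' t : nat).
Hypothesis tn : (t < n'.+1)%N.
Local Notation n := n'.+1.
Local Notation N := (nsym n).
Local Notation S := {mpoly K[nsym n]}.
Local Notation theta := (theta K n t).
Local Notation delta0 := (@delta0 K n' t).
Local Notation zvar := (@zvar K n' t).
Local Notation lowt := (@low n' t).
Local Notation zpow := (ipow lowt zvar).
Implicit Types (p a s G : S) (v : 'I_N).

Section Compatible.
Context (q : nat) (k : K -> K).
Hypotheses (q_gt0 : (0 < q)%N).
Hypothesis frobS : forall a b : S, (a + b) ^+ q = a ^+ q + b ^+ q.
Hypotheses (kD : forall x y, k (x + y) = k x + k y)
  (kZ : forall a x : K, k (a ^+ q * x) = a * k x) (k1 : k 1 = 1).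
Local Notation tr := (trace q k).

(* Fedder's criterion at the generic point of the determinantal variety, where
   the ideal is generated by the [#|lowt|] elements [zvar v]. *)
Lemma trace_compatible G M : zpow (\sum_(v | lowt v) q.-1) (delta0 ^+ M * G) ->
  forall s, theta s = 0 -> theta (tr (G * s)) = 0.
Proof.
move=> hG s /(theta_zpow tn) [L hs].
have : ideal_span (frob_gen lowt zvar q) (delta0 ^+ (q * (M + L)) * (G * s)).
  (* One factor [delta0 ^+ (M + L)] brings [G * s] into the ideal power that [ipow_frob] requires;
     the others complete a [q]-th power, which can leave the trace. *)
  have -> : delta0 ^+ (q * (M + L)) * (G * s) =
      delta0 ^+ (q.-1 * (M + L)) * ((delta0 ^+ M * G) * (delta0 ^+ L * s)).
    rewrite -[in LHS](prednK q_gt0) mulSn exprD exprD; ring.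
  apply/ideal_spanM/(ipow_frob q_gt0).
  by have := ipowM hG hs; rewrite addn1.
move=> H; apply: (theta_delta0_cancel tn (N := (M + L))).
rewrite -(trace_semilinear q_gt0 frobS kD kZ) -exprM [((M + L) * q)%N]mulnC.
move: H => [l [hl ->]]; rewrite (trace_sum q_gt0 kD) rmorph_sum big_seq big1 // => x xl.
have [v lv ->] := hl x xl.
rewrite mulrC (trace_semilinear q_gt0 frobS kD kZ) rmorphM theta_zvar //.
by rewrite mul0r.
Qed.

Definition botm : 'X_{1..N} := [multinom q.-1 | _ < N].

Lemma troot_botm (m : 'X_{1..N}) : troot q m = (m *+ q + botm)%MM.
Proof. by apply/mnmP => i; rewrite mnmDE mulmnE !mnmE. Qed.

(** The trace reads only exponents [m *+ q + botm], whose weight is at least that of [botm]; terms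
    of weight below [d] are invisible to it. *)
Lemma trace_botm (w : 'I_N -> nat) d p r :
  (d <= wt w botm)%N -> wlead w d p r -> tr p = tr r.
Proof.
move=> dw L; apply/mpolyP => m; rewrite !(trace_coeff q_gt0 kD); congr k.
apply: (wlead_coeff L); rewrite troot_botm wtD.
by apply: leq_trans dw _; rewrite leq_addl.
Qed.

Lemma trace_Xbotm : tr 'X_[botm] = 1.
Proof.
apply/mpolyP => m; rewrite (trace_coeff q_gt0 kD) mcoeffX mcoeff1 troot_botm.
rewrite -[X in X == _]add0m eqm_add2r.
have -> : (0 == m *+ q)%MM = (m == 0%MM).
  apply/eqP/eqP => [/mnmP E|->]; last first.
    by apply/mnmP => i; rewrite mulmnE mnm0E.
  apply/mnmP => i; have := E i; rewrite mulmnE !mnm0E => /eqP.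
  by rewrite eq_sym muln_eq0 (gtn_eqF q_gt0) orbF => /eqP.
by case: (m == 0%MM); rewrite ?k1 // (semilinear0 kD).
Qed.

(** For the degree in the low variables, the product of the [zvar v ^+ q.-1] leads with that of the
    [(delta0 * 'X_v) ^+ q.-1], and the trace sees nothing else. The other factors of [G] complete a
    [q]-th power of [delta0] and isolate one coefficient of [a]. *)
Lemma generic_trace a : topp t a -> a != 0 -> (msize a <= q)%N ->
  exists G, [/\ forall s, theta s = 0 -> theta (tr (G * s)) = 0 &
                tr (G * a) = delta0 ^+ (\sum_(v | lowt v) 1)].
Proof.
move=> ha a0 aq; pose h := (\sum_(v | lowt v) 1)%N.
have [m0 m0a] : exists m0, m0 \in msupp a.
  move: a0; rewrite -msupp_eq0; case: (msupp a) => // m0 l _.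
  by exists m0; rewrite mem_head.
have ltq m : m \in msupp a -> forall v, (m v < q)%N.
  move=> ma v; have := msize_mdeg_lt ma; rewrite mdegE (bigD1 v) //= => H.
  by apply: leq_trans aq; apply: leq_ltn_trans H; rewrite leq_addr.
have m0low v : lowt v -> m0 v = 0%N.
  move=> lv; have : wt (lowdeg t) m0 == 0%N.
    by rewrite -leqn0 -ltnS ltnNge; move: m0a; rewrite mcoeff_msupp; apply: contra => /ha ->.
  rewrite /wt sum_nat_eq0 => /forallP /(_ v) /=.
  by rewrite /lowdeg lv muln1 => /eqP.
(* [b] complements [m0] to exponent [q.-1] in the variables that are not low; the low ones get
   theirs from [G1]. *)
pose b : 'X_{1..N} := [multinom (if lowt v then 0 else q.-1 - m0 v)%N | v < N].
pose G1 := \prod_(v | lowt v) zvar v ^+ q.-1.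
pose U := delta0 ^+ h * 'X_[b] * (a@_m0)^-1%:MP.
exists (G1 * U); split.
  apply: (trace_compatible (M := 0)); rewrite expr0 mul1r mulrC; apply: ideal_spanM.
  have -> : (\sum_(v | lowt v) q.-1 = \sum_(v | lowt v) q.-1 * 1)%N.
    by apply: eq_bigr => v _; rewrite muln1.
  by apply: ipow_prod => v lv; apply/ipowXn/ipow_gen_z.
have toppU : topp t (U * a).
  apply: toppM => //; apply: toppM; last exact: toppC.
  apply: toppM; first by apply/toppXn/topp_delta0.
  apply: wltX; rewrite ltnS leqn0 sum_nat_eq0; apply/forallP => v /=.
  by rewrite mnmE /lowdeg; case: (low _ _); rewrite ?mul0n ?muln0.
have wh : wt (lowdeg t) botm = (\sum_(v | lowt v) q.-1 * 1)%N.
  rewrite /wt [RHS]big_mkcond; apply: eq_bigr => v _; rewrite mnmE /lowdeg.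
  by case: (low _ _); rewrite ?muln1 ?muln0.
have L : wlead (lowdeg t) (\sum_(v | lowt v) q.-1 * 1) G1
    (\prod_(v | lowt v) (delta0 * 'X_v) ^+ q.-1).
  apply: wlead_prod => v lv; apply: wleadXn; have [c hc ->] := zvar_split K tn v; split.
    rewrite -[2%N]add0n; apply: wltM; first exact: topp_delta0.
    by apply: wltX; rewrite wtU /lowdeg lv.
  by rewrite addrAC subrr add0r; apply: wltN.
have LU := wleadM L (wlead_refl toppU : wlead (lowdeg t) 0 (U * a) (U * a)).
rewrite -mulrA (trace_botm _ LU); last by rewrite wh addn0.
have -> : \prod_(v | lowt v) (delta0 * 'X_v) ^+ q.-1 * (U * a) =
    (delta0 ^+ h) ^+ q * ('X_[\sum_(v | lowt v) U_(v) *+ q.-1 + b] * ((a@_m0)^-1%:MP * a)).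
  rewrite (eq_bigr (fun v => delta0 ^+ q.-1 * 'X_v ^+ q.-1)) => [|v _]; last by rewrite exprMn.
  have dq : (delta0 ^+ h) ^+ q = (delta0 ^+ q.-1) ^+ h * delta0 ^+ h.
    by case: (q) q_gt0 => // q1 _; rewrite exprSr -!exprM [(h * q1)%N]mulnC.
  have ch : #|lowt| = h by rewrite /h sum1_card.
  rewrite big_split /= prodr_const ch mprodXnE mpolyXD /U dq.
  move: (delta0 ^+ h) (_ ^+ h) => x y; ring.
rewrite (trace_semilinear q_gt0 frobS kD kZ) -[RHS]mulr1; congr (_ * _).
set be := (_ + b)%MM.
have beE v : be v = (q.-1 - m0 v)%N.
  rewrite mnmDE mnm_sumE mnmE; have [lv|lv] := boolP (lowt v).
    rewrite (bigD1 v) //= mulmnE mnm1E eqxx mul1n big1 => [|i /andP [_ /negPf iv]].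
      by rewrite !addn0 m0low // subn0.
    by rewrite mulmnE mnm1E iv.
  rewrite big1 ?add0n // => i li; rewrite mulmnE mnm1E.
  by have [E|//] := eqVneq i v; rewrite E (negPf lv) in li.
apply/mpolyP => m; rewrite (trace_coeff q_gt0 kD) mcoeff1.
have -> : troot q m = (be + (m *+ q + m0))%MM.
  apply/mnmP => v; rewrite [troot q m v]mnmE [RHS]mnmDE beE mnmDE mulmnE.
  have := ltq _ m0a v; move: q_gt0; lia.
rewrite mulrC mcoeffMX mcoeffCM; have [->|m_neq0] := eqVneq m 0%MM.
  have -> : (0 *+ q)%MM = 0%MM :> 'X_{1..N}.
    by apply/mnmP => v; rewrite mulmnE !mnm0E.
  by rewrite add0m mulVf ?k1 // -mcoeff_msupp.
(* Since [msize a <= q], the exponents in [a] stay below [q], which rules out a nonzero [m]. *)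
suff -> : a@_(m *+ q + m0) = 0 by rewrite mulr0 (semilinear0 kD).
apply/memN_msupp_eq0/negP => /ltq H.
case/eqP: m_neq0; apply/mnmP => v; rewrite mnm0E; have := H v.
rewrite mnmDE mulmnE.
by case: (m v) => // j; rewrite mulSn ltnNge -addnA leq_addr.
Qed.

End Compatible.

End Descent.

(** * Corner minors *)

Section Corner.
Context (K : fieldType) (n' t : nat).
Hypothesis tn : (t < n'.+1)%N.
Local Notation n := n'.+1.
Local Notation N := (nsym n).
Local Notation S := {mpoly K[nsym n]}.
Local Notation X := (symX K n).
Local Notation theta := (theta K n t).
Local Notation delta0 := (@delta0 K n' t).
Local Notation zvar := (@zvar K n' t).
Local Notation lowt := (@low n' t).
Local Notation zpow := (ipow lowt zvar).
Local Notation lo k := (@lo n' k).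
Local Notation hi k := (@hi n' k).

Lemma big_sympr (T : Type) (idx : T) (op : Monoid.com_law idx) (F : 'I_n * 'I_n -> T) :
  \big[op/idx]_v F (sympr v) = \big[op/idx]_(i < n) \big[op/idx]_(j < n | (i <= j)%N) F (i, j).
Proof.
rewrite pair_big_dep /=.
rewrite [RHS](reindex_onto (@sympr n) (fun p => symvar p.1 p.2)) /=; last first.
  by move=> [i j] /= ij; rewrite sympr_symvar /sympair ij.
apply: eq_big => v; last by rewrite -surjective_pairing.
by rewrite sympr_le symvar_sympr eqxx.
Qed.

(** The count goes by columns. The truncated difference [j.+1 - t] is also the order that
    [corner_order] gives for the corner minor of size [j.+1]. *)
Lemma card_low : (\sum_(v | lowt v) 1 = \sum_(j < n) (j.+1 - t))%N.
Proof.
rewrite big_mkcond (big_sympr addn (fun p => if (t <= p.1)%N then 1%N else 0%N)).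
rewrite (exchange_big_dep xpredT) //=; apply: eq_bigr => j _.
rewrite -(big_ord_widen n (fun i => if (t <= i)%N then 1%N else 0%N) (ltn_ord j)).
elim: (j.+1) => [|m IH]; first by rewrite big_ord0.
by rewrite big_ord_recr /= IH; case: leqP; lia.
Qed.

Definition corner k : S := \det (mxsub (lo k) (hi k) X).

Lemma Zmx_zpow (i j : 'I_n) : zpow 1 (Zmx K n' t i j).
Proof.
have [l|l] := boolP (lowt (symvar i j)); first by rewrite -zvar_symvar; apply: ipow_gen_z.
by rewrite Zmx_low //; apply: ideal_span0.
Qed.

(** Scaled by [delta0], the corner submatrix is a submatrix of [Zmx] plus a product through [t]
    columns, so [det_filtration] applies to the ideal powers. *)
Lemma corner_order k : zpow (k - t) (delta0 ^+ k * corner k).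
Proof.
rewrite -detZ; have -> : delta0 *: mxsub (lo k) (hi k) X = mxsub (lo k) (hi k) (Zmx K n' t) +
    rowsub (lo k) (cols0 K n' t *m \adj (P0 K n' t)) *m colsub (hi k) (cols0 K n' t)^T.
  by rewrite -mxsub_mul /Zmx; apply/matrixP => i j; rewrite !mxE subrK.
apply: det_filtration.
- exact: ipow0.
- by move=> d; apply: ideal_span0.
- by move=> d e x; apply: ipow_le.
- by move=> d x y; apply: ideal_spanD.
- by move=> d e x y; apply: ipowM.
- by move=> i j; rewrite mxE; apply: Zmx_zpow.
Qed.

Definition diagexp k : 'X_{1..N} := (\sum_a U_(symvar (lo k a) (hi k a)))%MM.

Lemma wlead_corner k : (k <= n)%N ->
  wlead (@symw n) (wt (@symw n) (diagexp k)) (corner k) 'X_[diagexp k].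
Proof.
move=> kn; have := wlead_minor K (lo_inc kn) (hi_inc kn).
rewrite mprodXE wt_sum; congr wlead; apply: eq_bigr => a _; by rewrite wtU.
Qed.

(** The main diagonal of the corner minor of size [k] runs parallel to that of [X] at distance
    [n - k]; these parallels partition the upper triangle. *)
Lemma sum_diagexp : (\sum_(k < n) diagexp k.+1 = \sum_v U_(v))%MM.
Proof.
rewrite [RHS](eq_bigr (fun v => U_(symvar (sympr v).1 (sympr v).2))%MM) => [|v _]; last first.
  by rewrite symvar_sympr.
rewrite (big_sympr (@mnm_add N) (fun p => U_(symvar p.1 p.2)%MM)) /=.
have E (k : 'I_n) : diagexp k.+1 =
    (\sum_(a < n | (a <= k)%N) U_(symvar (inord a) (inord (a + (n - k.+1)))))%MM.
  rewrite /diagexp -(big_ord_widen n (fun a =>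
     U_(symvar (inord a) (inord (a + (n - k.+1)))) : 'X_{1..N})%MM (ltn_ord k)).
  by [].
rewrite (eq_bigr _ (fun k _ => E k)) (exchange_big_dep xpredT) //=.
apply: eq_bigr => a _.
(* In row [a], the diagonal of size [k.+1] meets column [n' + a - k]; [r] exchanges sizes and
   columns. *)
pose r (j : 'I_n) : 'I_n := inord (n' + a - j).
have rE (j : 'I_n) : (a <= j)%N -> r j = (n' + a - j)%N :> nat.
  by move=> aj; rewrite inordK //; have := ltn_ord j; lia.
have rr (j : 'I_n) : (a <= j)%N -> r (r j) = j.
  move=> aj; apply: val_inj => /=; have r1 := rE j aj; have jn := ltn_ord j.
  by rewrite rE r1; lia.
rewrite (reindex_onto r r) //=; apply: eq_big => j.
  have [aj|ja] := leqP a j; first by rewrite rr // eqxx andbT rE //; have := ltn_ord j; lia.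
  apply/negP => /andP [arj /eqP rj]; have := rE _ arj; rewrite rj => E'.
  have := ltn_ord (r j); have := ltn_ord a; move: arj ja E'; lia.
move=> /andP [arj /eqP rj].
have aj : (a <= j)%N by rewrite -rj rE //; have := ltn_ord (r j); lia.
have jn := ltn_ord j.
rewrite inord_val; congr (U_(symvar a _))%MM; apply: val_inj; rewrite /= rE // inordK; lia.
Qed.

(** The hypothesis leaves [e k] free for [k.+1 <= t], where the order is 0. This lets [corner_trace]
    lower the exponent of the minor of size [t]. *)
Lemma corner_prod_order (e : 'I_n -> nat) (c : nat) :
  (forall k : 'I_n, (k.+1 - t) * e k = (k.+1 - t) * c)%N ->
  exists M, zpow (\sum_(v | lowt v) c)
    (delta0 ^+ M * \prod_(k < n) corner k.+1 ^+ e k).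
Proof.
move=> he; exists (\sum_(k < n) k.+1 * e k)%N.
have -> : (\sum_(v | lowt v) c = \sum_(k < n) e k * (k.+1 - t))%N.
  have -> : (\sum_(v | lowt v) c = (\sum_(v | lowt v) 1) * c)%N.
    by rewrite big_distrl /=; apply: eq_bigr => v _; rewrite mul1n.
  by rewrite card_low big_distrl /=; apply: eq_bigr => k _; rewrite -he mulnC.
rewrite -prodrXr -big_split /=; apply: ipow_prod => k _.
rewrite exprM -exprMn; exact/ipowXn/corner_order.
Qed.

(** If [A] and [B] are the first and last [t] columns of [genY], the three minors map to the squares
    of [\det A] and [\det B] and to the product of these determinants. *)
Lemma corner_theta :
  theta (delta0 * \det (mxsub (hi t) (hi t) X) - corner t ^+ 2) = 0.
Proof.
rewrite rmorphB rmorphXn rmorphM /delta0 /P0 /corner !theta_det !det_mulmx !det_tr.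
by apply/eqP; rewrite subr_eq0; apply/eqP; ring.
Qed.

Section CornerTrace.
Context (q : nat) (k : K -> K).
Hypotheses (q_gt0 : (0 < q)%N).
Hypothesis frobS : forall a b : S, (a + b) ^+ q = a ^+ q + b ^+ q.
Hypotheses (kD : forall x y, k (x + y) = k x + k y)
  (kZ : forall a x : K, k (a ^+ q * x) = a * k x) (k1 : k 1 = 1).
Local Notation tr := (trace q k).

(* The product of all corner minors has leading monomial the product of all
   the variables, so that its [q.-1]-st power has trace [1]. *)
Lemma trace_corner : tr (\prod_(j < n) corner j.+1 ^+ q.-1) = 1.
Proof.
have E : botm n' q = (\sum_(j < n) diagexp j.+1 *+ q.-1)%MM.
  apply/mnmP => v; rewrite mnm_sumE mnmE.
  under eq_bigr do rewrite mulmnE.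
  rewrite -big_distrl -mnm_sumE sum_diagexp mnm_sumE (bigD1 v) //= mnm1E eqxx big1.
    by rewrite mul1n.
  by move=> i /negPf iv; rewrite mnm1E iv.
have L : wlead (@symw n) (wt (@symw n) (botm n' q))
    (\prod_(j < n) corner j.+1 ^+ q.-1) 'X_[botm n' q].
  rewrite E -mprodXnE wt_sum; under eq_bigr do rewrite wtMn.
  by apply: wlead_prod => j _; apply/wleadXn/wlead_corner.
by rewrite (trace_botm q_gt0 kD (leqnn _) L) (trace_Xbotm _ q_gt0 kD k1).
Qed.

Lemma corner_trace h : (h <= q.-1)%N -> (0 < t)%N ->
  exists G, [/\ forall s, theta s = 0 -> theta (tr (G * s)) = 0 &
                tr (G * corner t ^+ h) = 1].
Proof.
move=> hq t0; have tn' : (t.-1 < n)%N by apply: leq_ltn_trans tn; rewrite leq_pred.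
pose t1 := Ordinal tn'.
pose e (j : 'I_n) := if j == t1 then (q.-1 - h)%N else q.-1.
exists (\prod_(j < n) corner j.+1 ^+ e j); split.
  have [j|M hM] := @corner_prod_order e q.-1; last exact: (trace_compatible _ _ _ _ _ hM).
  by rewrite /e; case: eqP => [->|//]; rewrite /= prednK // subnn.
apply: etrans trace_corner; congr trace; rewrite (bigD1 t1) //= [RHS](bigD1 t1) //=.
rewrite /e eqxx prednK // mulrAC -exprD subnK //; congr (_ * _).
by apply: eq_bigr => j /negPf ->.
Qed.

End CornerTrace.

End Corner.

(** * Splitting *)

Lemma frobenius_add (R : comNzRingType) (p e : nat) (a b : R) :
  p \in [pchar R] -> (a + b) ^+ (p ^ e) = a ^+ (p ^ e) + b ^+ (p ^ e).
Proof.
move=> hp; apply: exprDn_pchar; rewrite (eq_pnat _ (pcharf_eq hp)) pnatX.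
by rewrite pnat_id ?orTb // (pcharf_prime hp).
Qed.

Lemma symdet_F_split (p : nat) (K : fieldType) (hp : p \in [pchar K]) (n' t : nat)
    (c : {mpoly K[nsym n'.+1]}) : (0 < t)%N -> (t < n'.+1)%N ->
  theta K n'.+1 t c != 0 ->
  exists (e : nat) (phi : {mpoly K[nsym n'.+1]} -> {mpoly K[nsym n'.+1]}),
    [/\ forall a b, phi (a + b) = phi a + phi b,
        forall r s, phi (r ^+ (p ^ e) * s) = r * phi s,
        forall s, theta K n'.+1 t s = 0 -> theta K n'.+1 t (phi s) = 0 &
        theta K n'.+1 t (phi c - 1) = 0].
Proof.
move=> t0 tn c0; set th := theta K n'.+1 t.
have hpS : p \in [pchar {mpoly K[nsym n'.+1]}] := 
    rmorph_pchar (@mpolyC (nsym n'.+1) K : {rmorphism K -> {mpoly K[nsym n'.+1]}}) hp.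
have p1 : (1 < p)%N := prime_gt1 (pcharf_prime hp).
have q0 e : (0 < p ^ e)%N by rewrite expn_gt0 ltnW.
have fK e (a b : K) := frobenius_add e a b hp.
have fS e (a b : {mpoly K[nsym n'.+1]}) := frobenius_add e a b hpS.
have [M [a [ha hca]]] := eliminate tn c.
have thca := zpow_theta tn hca.
have a0 : a != 0.
  apply/eqP => a0; move: thca; rewrite a0 subr0 => /(theta_delta0_cancel tn) E.
  by rewrite E eqxx in c0.
pose h := (\sum_(v | @low n' t v) 1)%N.
(* As [p ^ e > e], these exponents meet the size bounds of [generic_trace] and [corner_trace]. *)
pose e1 := msize a; pose e2 := (h * 2)%N.+1.
have [k1 [k1D k1Z k11]] := exists_root_map (q0 e1) (fK e1).
have [k2 [k2D k2Z k21]] := exists_root_map (q0 e2) (fK e2).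
have [|G1 [G1I G1a]] := generic_trace tn (q0 e1) (fS e1) k1D k1Z k11 ha a0.
  by apply: ltnW; apply: ltn_expl.
have [|G2 [G2I G2d]] := corner_trace tn (q0 e2) (fS e2) k2D k2Z k21 (h := (h * 2)%N) _ t0.
  by rewrite -ltnS prednK // (leq_trans _ (ltn_expl e2 p1)).
pose D := \det (mxsub (@hi n' t) (@hi n' t) (symX K n'.+1)).
(* Modulo the kernel, the inner trace takes [c] to [delta0 ^+ h], the factor [D ^+ h] turns this
   into the corner minor to the power [h * 2], and the outer trace takes that to 1. *)
exists (e1 + e2)%N, (fun s => trace (p ^ e2) k2
  (G2 * (D ^+ h * trace (p ^ e1) k1 (G1 * (delta0 K n' t ^+ M * s))))).
split.
- by move=> x y; rewrite !(mulrDr, traceD (q0 _) k1D, traceD (q0 _) k2D).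
- move=> r s; rewrite expnD mulnC exprM.
  rewrite [_ ^+ M * _]mulrCA [G1 * _]mulrCA (trace_semilinear (q0 _) (fS _) k1D k1Z).
  by rewrite [D ^+ h * _]mulrCA [G2 * _]mulrCA (trace_semilinear (q0 _) (fS _) k2D k2Z).
- by move=> s s0; apply: G2I; rewrite rmorphM G1I ?mulr0 // rmorphM s0 mulr0.
have E1 : th (trace (p ^ e1) k1 (G1 * (delta0 K n' t ^+ M * c))) = th (delta0 K n' t) ^+ h.
  rewrite -[_ ^+ M * c](subrK a) mulrDr (traceD (q0 _) k1D) rmorphD G1I // add0r.
  by rewrite G1a rmorphXn.
set Y := D ^+ h * _.
rewrite -[Y](subrK (corner K n' t ^+ (h * 2))) mulrDr (traceD (q0 _) k2D) G2d addrK.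
apply: G2I; rewrite rmorphB rmorphM E1 [(h * 2)%N]mulnC exprM !rmorphXn -exprMn -rmorphM [D * _]mulrC.
have := corner_theta K n' t; rewrite rmorphB => /eqP; rewrite subr_eq0 => /eqP ->.
by rewrite rmorphXn subrr.
Qed.

(* R together with a surjective ring morphism K[X] -> R with kernel I_{t+1}(X)
   is (a copy of) K[X]/I_{t+1}(X). *)
Theorem theorem2p2 (p : nat) (K : fieldType) (hp : p \in [pchar K])
  (n t : nat) (ht : (0 < t)%N) (htn : (t.+1 <= n)%N)
  (R : comPzRingType) (pi : {rmorphism {mpoly K[nsym n]} -> R})
  (pi_surj : forall r : R, exists q, pi q = r)
  (pi_ker : forall q, pi q = 0 <-> @minors_ideal K n t q) :
  F_regular p R.
Proof.
case: n htn pi pi_surj pi_ker => // n' tn pi pi_surj pi_ker.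
have ker q : pi q = 0 <-> theta K n'.+1 t q = 0.
  by split=> [/pi_ker /theta_ker|/theta_ker /pi_ker].
(* The quotient embeds in a polynomial ring, so 0 is its only minimal prime and [c] is nonzero. *)
have zero_prime : is_prime_ideal (fun r : R => r = 0).
  split; first by split=> //; split=> [a b -> ->|r a ->]; rewrite ?addr0 ?mulr0.
  split=> [/eqP|a b].
    by rewrite -(rmorph1 pi) => /eqP /ker /eqP; rewrite rmorph1 oner_eq0.
  have [x <-] := pi_surj a; have [y <-] := pi_surj b.
  rewrite -rmorphM => /ker; rewrite rmorphM => /eqP; rewrite mulf_eq0.
  by case/orP => /eqP /ker; [left | right].
move=> c hc; have [x xc] := pi_surj c.
have [|e [phi [phiD phiZ phiI phix]]] := symdet_F_split hp (c := x) ht tn.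
  apply/eqP => /ker x0; apply: (hc (fun r => r = 0)); last by rewrite -xc.
  by split=> // Q [[Q0 _] _] _ r ->.
have ex_lift r : exists q, pi q == r by have [q <-] := pi_surj r; exists q.
pose lift r := xchoose (ex_lift r).
have liftK r : pi (lift r) = r by apply/eqP/(xchooseP (ex_lift r)).
(* Since [phi] preserves the kernel, the choice of lifts does not matter, which makes the induced
   map additive and semilinear. *)
have phi_eq q q' : pi q = pi q' -> pi (phi q) = pi (phi q').
  move=> E; rewrite -(subrK q' q) phiD rmorphD.
  have /ker -> : theta K n'.+1 t (phi (q - q')) = 0; last by rewrite add0r.
  by apply: phiI; apply/ker; rewrite rmorphB E subrr.
exists e, (fun r => pi (phi (lift r))); split=> [a b|]; last split=> [r s|].
- rewrite -rmorphD -phiD; apply: phi_eq; by rewrite rmorphD !liftK.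
- rewrite -[in RHS](liftK r) -rmorphM -phiZ; apply: phi_eq.
  by rewrite rmorphM rmorphXn !liftK.
- rewrite (phi_eq _ x) ?liftK //; apply/eqP; rewrite -subr_eq0 -(rmorph1 pi) -rmorphB.
  by apply/eqP/ker.
Qed.
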